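(* Let $p,q$ be positive integers with $p\le q$ and $n=p+q$. (i) If $p=2$ (and $n\ge 4$), then every tree in $\mathscr{T}_n^{2,n-2}$ is isomorphic to $T(n,3,i)$ for exactly one $i$ with $0\le i\le\lfloor (n-3)/2\rfloor$, and $$\operatorname{per} L(D(2,n-2))=\operatorname{per} L(T(n,3,0))<\operatorname{per} L(T(n,3,1))<\cdots<\operatorname{per} L(T(n,3,i))<\cdots<\operatorname{per} L\big(T(n,3,\lfloor \tfrac{n-3}{2}\rfloor)\big).$$ (ii) If $p>2$, then: (a) for every $T\in\mathscr{T}_n^{p,q}$ not isomorphic to $D(p,q)$, $\operatorname{per} L(T)\ge (2p-3)(6q-5)+3$, with equality if and only if $T\cong D'(p-1,q-1)$; (b) if moreover $q>p$, then for every $T\in\mathscr{T}_n^{p,q}$ isomorphic to neither $D(p,q)$ nor $D'(p-1,q-1)$, $\operatorname{per} L(T)\ge (2q-3)(6p-5)+3$, with equality if and only if $T\cong D''(p-1,q-1)$.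
   Context: For a simple graph $G$, $L(G)=D(G)-A(G)$ is its Laplacian matrix ($D(G)$ the diagonal degree matrix, $A(G)$ the adjacency matrix), and $\operatorname{per} X=\sum_{\sigma\in S_n}\prod_{t=1}^n x_{t\sigma(t)}$ is the permanent of an $n\times n$ matrix $X$. A connected graph has a $(p,q)$-bipartition if its vertex set splits into two parts of sizes $p$ and $q$ with every edge joining the two parts; $\mathscr{T}_n^{p,q}$ is the set of all trees on $n=p+q$ vertices with a $(p,q)$-bipartition (with $p\le q$). $D(p,q)$ is the double star on $p+q$ vertices obtained from an edge $vw$ by attaching $p-1$ pendant vertices to $v$ and $q-1$ pendant vertices to $w$. $D'(p-1,q-1)$ (resp. $D''(p-1,q-1)$) is the tree on $p+q$ vertices obtained from $D(p-1,q-1)$ (with $p-2$ pendant vertices at $v$ and $q-2$ at $w$) by attaching a pendant path of length 2 at $w$ (resp. at $v$). $T(n,k,a)$ is the tree on $n$ vertices obtained from the path $P_k$ by attaching $a$ pendant vertices to one end-vertex and $n-k-a$ pendant vertices to the other end-vertex. *)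

(* Defs.v *)
From mathcomp Require Import all_boot all_order all_algebra all_fingroup.
Unset Printing Implicit Defensive.
Import GRing.Theory Num.Theory.
Local Open Scope ring_scope.

Definition simple_graph (n : nat) (e : rel 'I_n) : Prop :=
  symmetric e /\ irreflexive e.

Definition n_edges (n : nat) (e : rel 'I_n) : nat :=
  (#|[set u : 'I_n * 'I_n | e u.1 u.2]| %/ 2)%N.

Definition is_tree (n : nat) (e : rel 'I_n) : Prop :=
  simple_graph n e /\ (forall x y : 'I_n, connect e x y) /\ n_edges n e = n.-1.

Definition has_bipartition (n : nat) (e : rel 'I_n) (p q : nat) : Prop :=
  exists A : {set 'I_n},
    #|A| = p /\ #|~: A| = q /\ (forall x y, e x y -> (x \in A) != (y \in A)).

Definition in_Tpq (n p q : nat) (e : rel 'I_n) : Prop :=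
  is_tree n e /\ has_bipartition n e p q.

Definition graph_iso (n : nat) (e1 e2 : rel 'I_n) : Prop :=
  exists s : 'S_n, forall x y : 'I_n, e1 x y = e2 (s x) (s y).

Definition deg (n : nat) (e : rel 'I_n) (i : 'I_n) : nat := #|[set j | e i j]|.

Definition laplacian (n : nat) (e : rel 'I_n) : 'M[int]_n :=
  \matrix_(i, j) (if i == j then (deg n e i)%:Z else if e i j then -1 else 0).

Definition per (R : comPzRingType) (n : nat) (A : 'M[R]_n) : R :=
  \sum_(s : 'S_n) \prod_(i < n) A i (s i).

(* A tree given by a parent function on vertex labels (vertex 0 is the root,
   with par 0 = 0): x ~ y iff x <> y and one is the parent of the other. *)
Definition tree_of_par (n : nat) (par : nat -> nat) : rel 'I_n :=
  fun x y => (x != y) && ((par x == y) || (par y == x)).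

(* D(p,q): v = 0, w = 1, vertices 2..p pendant at v (p-1 of them),
   vertices p+1..p+q-1 pendant at w (q-1 of them). *)
Definition par_D (p q : nat) (i : nat) : nat := if (i <= p)%N then 0%N else 1%N.
Definition Dtree (p q : nat) : rel 'I_(p + q) := tree_of_par (p + q) (par_D p q).

(* D'(p-1,q-1): v = 0, w = 1, vertices 2..p-1 pendant at v (p-2),
   vertices p..p+q-3 pendant at w (q-2), and a pendant path
   w - (p+q-2) - (p+q-1) of length 2 at w. *)
Definition par_D' (p q : nat) (i : nat) : nat :=
  if (i <= p.-1)%N then 0%N
  else if (i <= p + q - 2)%N then 1%N
  else (p + q - 2)%N.
Definition D'tree (p q : nat) : rel 'I_(p + q) := tree_of_par (p + q) (par_D' p q).

(* D''(p-1,q-1): same but the pendant path v - (p+q-2) - (p+q-1) is at v. *)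
Definition par_D'' (p q : nat) (i : nat) : nat :=
  if (i <= p.-1)%N then 0%N
  else if (i <= p + q - 3)%N then 1%N
  else if i == (p + q - 2)%N then 0%N
  else (p + q - 2)%N.
Definition D''tree (p q : nat) : rel 'I_(p + q) := tree_of_par (p + q) (par_D'' p q).

(* T(n,k,a): path 0 - 1 - ... - (k-1), with a pendant vertices
   k..k+a-1 at the end-vertex 0 and n-k-a pendant vertices k+a..n-1 at
   the end-vertex k-1. *)
Definition par_T (k a : nat) (i : nat) : nat :=
  if (i < k)%N then i.-1 else if (i < k + a)%N then 0%N else k.-1.
Definition Ttree (n k a : nat) : rel 'I_n := tree_of_par n (par_T k a).

(* Main.v *)
Require Import Defs.
From mathcomp Require Import all_boot all_order all_algebra all_fingroup.
From mathcomp Require Import zify.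
Import GRing.Theory Num.Theory.

(** A 2-colouring of the tree turns [per L(T)] into the permanent of the
    signless Laplacian, whose value [f(T)] is computed by expanding at leaves:
    attaching a leaf at [v] adds twice [g(T, v)], the permanent with the row and
    column of [v] deleted. If one colour class has a single vertex [w] of degree
    at least 2, then [T] has depth 2 around [w], and with [c] leaves on each of
    the [q] neighbours [f(T)] equals [q P + E], where [P] is the product of the
    numbers [2c+1] and [E] the sum of the products omitting one of them; this is
    minimised explicitly. Otherwise [T] contains an induced path on six vertices, and
    growing [T] from it leaf by leaf keeps [g(T, v) >= 6m-5], with [m] the size
    of the class of [v], so that [f(T)] stays above both bounds. *)

Set Implicit Arguments.
Unset Strict Implicit.
Unset Printing Implicit Defensive.

(** * Permanents of weighted graphs *)

(** The permanent alone does not carry an induction: its growth is governed by [g], and the growth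
    of [g] by permanents with two deleted vertices. The chain is cut there by the crude bound with
    the product of the degrees, which is at least 4 as soon as each colour class keeps a vertex of
    degree at least 2 besides the deleted one. This is why both classes must have two such vertices,
    and why the remaining trees need an exact formula. The slope 6 is forced by the target:
    [2(6n-5) = 12n-10] is precisely the increment of [(2m-3)(6n-5)+3] when [m] grows by one.

    The named trees are all spiders in which at most two branches carry leaves, so one predicate
    with two leaf counts describes them. The centre of D'(p-1,q-1) lies in the class of size p and
    that of D''(p-1,q-1) in the class of size q, while D(p,q) is such a spider around either end of
    its central edge. Hence each choice of the class of the centre yields one extremal tree besides
    D(p,q). *)

Definition wterm (V : finType) (d : V -> nat) (e : rel V) (s : {perm V}) (x : V) : nat :=
  if s x == x then d x else e x (s x).

(** [X] selects a principal submatrix. Permutations stay in [{perm V}] and the diagonal [d] is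
    independent of [X], so that deleting vertices keeps the degrees of the larger graph and involves
    no change of type. *)
Definition wper (V : finType) (d : V -> nat) (e : rel V) (X : {set V}) : nat :=
  \sum_(s : {perm V} | perm_on X s) \prod_(x in X) wterm d e s x.

Section WeightedPermanent.
Context {V : finType}.
Implicit Types (d : V -> nat) (e : rel V) (X : {set V}) (s : {perm V}) (x y u v : V).

Lemma wper_eq d d' e X : {in X, d =1 d'} -> wper d e X = wper d' e X.
Proof.
move=> dd; apply: eq_bigr => s _; apply: eq_bigr => x xX.
by rewrite /wterm dd.
Qed.

Lemma perm_on_fix X s u : u \in X ->
  perm_on X s && (s u == u) = perm_on (X :\ u) s.
Proof.
move=> uX; apply/andP/subsetP => [[/subsetP sX /eqP su] x | sX].
  rewrite !inE => sx; rewrite sX ?inE // andbT.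
  by apply: contra sx => /eqP ->; rewrite su.
split; first by apply/subsetP => x /sX; rewrite !inE => /andP[].
by apply: contraT => su; have := sX u su; rewrite !inE eqxx.
Qed.

Lemma wper_set0 d e : wper d e set0 = 1%N.
Proof.
rewrite /wper (big_pred1 1%g) ?big_set0 // => s /=.
apply/subsetP/eqP => [s0 | -> x]; last by rewrite !inE perm1 eqxx.
by apply/permP => x; rewrite perm1; apply/eqP/contraT => /s0; rewrite inE.
Qed.

Lemma wper_split d e X u : u \in X ->
  wper d e X = d u * wper d e (X :\ u)
   + \sum_(s : {perm V} | perm_on X s && (s u != u)) \prod_(x in X) wterm d e s x.
Proof.
move=> uX; rewrite {1}/wper (bigID (fun s => s u == u)) /=; congr (_ + _).
rewrite (eq_bigl _ _ (fun s => perm_on_fix s uX)) big_distrr /=.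
apply: eq_bigr => s; rewrite -perm_on_fix // => /andP[_ su].
by rewrite (big_setD1 u) //= {1}/wterm su.
Qed.

Lemma wper_isolated d e X u : u \in X -> {in X, forall y, y != u -> ~~ e u y} ->
  wper d e X = d u * wper d e (X :\ u).
Proof.
move=> uX eu; rewrite (wper_split _ _ uX) big1 ?addn0 // => s /andP[sX su].
rewrite (big_setD1 u) //= {1}/wterm (negPf su) (negPf (eu _ _ su)) //.
by rewrite (perm_closed _ sX).
Qed.

(** A nonzero term sends [u] to itself or to [v]; in the second case [v] must return to [u], since
    the preimage of [u] is adjacent to [u] as well. So only the permutations fixing [u] and those
    swapping [u] and [v] survive. *)
Lemma wper_pendant d e X u v : symmetric e -> u \in X -> v \in X -> e u v -> u != v ->
  {in X, forall y, y != u -> y != v -> ~~ e u y} ->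
  wper d e X = d u * wper d e (X :\ u) + wper d e (X :\ u :\ v).
Proof.
move=> esym uX vX euv uv eu; rewrite (wper_split _ _ uX); congr (_ + _).
have vXu : v \in X :\ u by rewrite !inE eq_sym uv.
rewrite (bigID (fun s => (s u == v) && (s v == u))) /= [X in _ + X]big1 ?addn0; last first.
  move=> s /andP[/andP[sX su] suv]; apply/eqP.
  have [suE|suv'] := eqVneq (s u) v; last first.
    rewrite (big_setD1 u) //= {1}/wterm (negPf su) (negPf (eu _ _ su suv')) //.
    by rewrite (perm_closed _ sX).
  have svu : s v != u by move: suv; rewrite suE eqxx.
  pose y := (s^-1)%g u.
  have sy : s y = u by rewrite /y permKV.
  have yX : y \in X by rewrite -(perm_closed _ sX) sy.
  have yu : y != u by apply: contra su => /eqP yu; rewrite -{1}yu sy.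
  have yv : y != v by apply: contra svu => /eqP <-; rewrite sy.
  have yu' : u != y by rewrite eq_sym.
  by rewrite (big_setD1 y) //= {1}/wterm sy (negPf yu') esym (negPf (eu _ yX yu yv)).
(* Composition with the transposition matches the permutations swapping [u] and [v] with those
   fixing both. *)
rewrite (reindex_onto (fun s => tperm u v * s)%g (fun s => tperm u v * s)%g) /=; last first.
  by move=> s _; rewrite mulgA tperm2 mul1g.
rewrite /wper.
have prE s : perm_on (X :\ u :\ v) s = perm_on X s && ((s u == u) && (s v == v)).
  by rewrite -(perm_on_fix s vXu) -perm_on_fix // andbA.
have tX : perm_on X (tperm u v).
  apply/subsetP => x; rewrite inE; case: tpermP => [->|->|]; rewrite ?uX ?vX //.
  by rewrite eqxx.
apply: eq_big => s.
  rewrite prE !permM tpermL tpermR mulgA tperm2 mul1g eqxx andbT -!andbA.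
  have -> : perm_on X (tperm u v * s)%g = perm_on X s.
    apply/idP/idP => sX; last exact: perm_onM.
    by rewrite -[s]mul1g -(tperm2 u v) -mulgA; apply: perm_onM.
  rewrite [(s v == v) && (s u == u)]andbC; congr (_ && _).
  have [-> |//] := eqVneq (s v) v; rewrite ?andbT ?andbF //=.
  by rewrite eq_sym uv.
rewrite !permM tpermL tpermR => /andP[/andP[/andP[sX _] /andP[/eqP sv /eqP su]] _].
rewrite (big_setD1 u) //= (big_setD1 v vXu) /= {1 2}/wterm !permM tpermL tpermR su sv.
rewrite (negPf uv) eq_sym (negPf uv) (esym v) euv !mul1n.
apply: eq_bigr => x; rewrite !inE => /and3P[xv xu _].
by rewrite /wterm permM tpermD // eq_sym.
Qed.

Lemma wper_incr d e X v : v \in X ->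
  wper (fun x => d x + (x == v)) e X = wper d e X + wper d e (X :\ v).
Proof.
move=> vX; rewrite !(wper_split _ e vX) eqxx mulnDl mul1n.
have -> : wper (fun x => d x + (x == v)) e (X :\ v) = wper d e (X :\ v).
  by apply: wper_eq => x; rewrite !inE => /andP[/negPf-> _]; rewrite addn0.
rewrite -!addnA; congr (_ + _); rewrite addnC; congr (_ + _).
apply: eq_bigr => s /andP[_ sv]; apply: eq_bigr => x _; rewrite /wterm.
case: eqP => // sx; have [xv|_] := eqVneq x v; last exact: addn0.
by rewrite -xv sx eqxx in sv.
Qed.

Lemma wper_ge_prod d e X : \prod_(x in X) d x <= wper d e X.
Proof.
rewrite /wper (bigD1 1%g) ?perm_on1 //=; apply: leq_trans (leq_addr _ _).
by apply: leq_prod => x _; rewrite /wterm perm1 eqxx.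
Qed.

End WeightedPermanent.

(** * Growing a tree leaf by leaf *)

Definition nbrs (V : finType) (e : rel V) (S : {set V}) (x : V) : nat :=
  \sum_(y in S) e x y.

Definition arcs (V : finType) (e : rel V) (S : {set V}) : nat :=
  \sum_(x in S) nbrs e S x.

Section Growth.
Context {V : finType} (e : rel V).
Hypotheses (esym : symmetric e) (eirr : irreflexive e).
Implicit Types (S X : {set V}) (x y u v : V).

Lemma nbrs_setU1 S u x : u \notin S -> nbrs e (u |: S) x = e x u + nbrs e S x.
Proof. by move=> uS; rewrite /nbrs big_setU1. Qed.

Lemma nbrs_gt0 S x y : y \in S -> e x y -> 0 < nbrs e S x.
Proof. by move=> yS exy; rewrite /nbrs (big_setD1 y) //= exy. Qed.

Lemma nbrs_sub S X x : S \subset X -> nbrs e S x <= nbrs e X x.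
Proof.
move=> SX; rewrite /nbrs [X in _ <= X](big_setID S) /= (setIidPr SX).
exact: leq_addr.
Qed.

Lemma arcs_setU1 S u : u \notin S -> arcs e (u |: S) = arcs e S + 2 * nbrs e S u.
Proof.
move=> uS; rewrite /arcs big_setU1 //= nbrs_setU1 // eirr add0n.
rewrite (eq_bigr (fun x => e x u + nbrs e S x)) => [|x _]; last exact: nbrs_setU1.
rewrite big_split /= (eq_bigr (fun x => nat_of_bool (e u x))) => [|x _].
  by rewrite -/(nbrs e S u); lia.
by rewrite esym.
Qed.

Section Leaf.
Variables (S : {set V}) (u v : V).
Hypotheses (uS : u \notin S) (vS : v \in S) (euv : e u v) (uS1 : nbrs e S u = 1).

Lemma leaf_adj x : x \in S -> e u x = (x == v).
Proof.
have [-> //|xv xS] := eqVneq x v.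
move: uS1; rewrite /nbrs (big_setD1 v) //= euv (big_setD1 x) ?inE ?xv //=.
by case: (e u x).
Qed.

Lemma wper_leaf_degree X : X \subset S ->
  wper (nbrs e (u |: S)) e X =
  wper (nbrs e S) e X + (v \in X) * wper (nbrs e S) e (X :\ v).
Proof.
move=> XS.
rewrite (wper_eq (d' := fun x => nbrs e S x + (x == v))); last first.
  move=> x xX; rewrite nbrs_setU1 // esym leaf_adj ?(subsetP XS) //.
  exact: addnC.
have [vX|vX] := boolP (v \in X); first by rewrite wper_incr // mul1n.
rewrite mul0n addn0; apply: wper_eq => x xX.
have -> : (x == v) = false by apply: contraNF vX => /eqP <-.
by rewrite addn0.
Qed.

(** The coefficient 2 collects two copies of one permanent: the first because the degree of [v]
    rises, the second from the permutations swapping [u] and [v]. If [v] is not in [X], then [u] is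
    isolated with diagonal entry 1. *)
Lemma wper_leaf X : X \subset S ->
  wper (nbrs e (u |: S)) e (u |: X) =
  wper (nbrs e S) e X + 2 * (v \in X) * wper (nbrs e S) e (X :\ v).
Proof.
move=> XS.
have uX : u \notin X by apply: contra uS => /(subsetP XS).
have du : nbrs e (u |: S) u = 1 by rewrite nbrs_setU1 // eirr uS1.
have XU : (u |: X) :\ u = X by rewrite setU1K.
have uv : u != v by apply: contraNneq uS => ->.
have sub y : y \in u |: X -> y != u -> y \in S.
  by rewrite !inE => /orP[/eqP->|/(subsetP XS)//]; rewrite eqxx.
have [vX|vX] := boolP (v \in X).
  rewrite (@wper_pendant _ _ _ _ u v) ?setU11 ?inE ?vX ?orbT //; last first.
    by move=> y yX yu yv; rewrite leaf_adj ?sub.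
  rewrite XU du wper_leaf_degree // vX wper_leaf_degree ?(subset_trans (subsetDl _ _)) //.
  rewrite !inE eqxx /=; lia.
rewrite (@wper_isolated _ _ _ _ u) ?setU11 //; last first.
  move=> y yX yu; rewrite leaf_adj ?sub //.
  by apply: contraNneq vX => <-; move: yX; rewrite !inE (negPf yu).
by rewrite XU du wper_leaf_degree // (negPf vX); lia.
Qed.

End Leaf.

(* Consecutive entries need not be adjacent, so deleting a vertex from an induced
   path leaves a [path_like] list. *)
Fixpoint path_like (l : seq V) : bool :=
  if l is x :: l' then
    (if l' is y :: l'' then all (fun z => ~~ e x z) l'' else true) && path_like l'
  else true.

(** The three-term recursion for the permanent of a tridiagonal matrix with 0/1 entries off the
    diagonal. *)
Fixpoint continuant (d : V -> nat) (l : seq V) : nat :=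
  if l is x :: l' then
    d x * continuant d l' + (if l' is y :: l'' then e x y * continuant d l'' else 0)
  else 1.

Lemma wper_path d l : uniq l -> path_like l -> wper d e [set x in l] = continuant d l.
Proof.
have [k] := ubnP (size l); elim: k l => // k IH [|x l] /=.
  by rewrite set_nil wper_set0.
move=> lk /andP[xl ul] /andP[nx pl].
have D : [set z in x :: l] :\ x = [set z in l].
  rewrite set_cons setU1K // inE //.
have xX : x \in [set z in x :: l] by rewrite inE mem_head.
case: l => [|y l] in lk xl ul nx pl D xX *.
  rewrite (@wper_isolated _ _ _ _ x) // ?D ?IH ?addn0 //.
  by move=> y; rewrite !inE => ->.
have yX : y \in [set z in [:: x, y & l]] by rewrite !inE eqxx orbT.
have xy : x != y by apply: contraNneq xl => ->; rewrite mem_head.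
have D2 : [set z in y :: l] :\ y = [set z in l].
  by rewrite set_cons setU1K // inE; case/andP: ul.
have nxz z : z \in [set z in [:: x, y & l]] -> z != x -> z != y -> ~~ e x z.
  by rewrite !inE => /or3P[->|->|/(allP nx)].
have IH1 : wper d e [set z in y :: l] = continuant d (y :: l) by apply: IH; rewrite //=; lia.
have [exy|nexy] := boolP (e x y).
  have IH2 : wper d e [set z in l] = continuant d l.
    apply: IH; first by move: lk => /=; lia.
      by case/andP: ul.
    by move: pl => /= /andP[].
  rewrite (@wper_pendant _ _ _ _ x y) // D D2 IH1 IH2. by rewrite mul1n.
rewrite (@wper_isolated _ _ _ _ x) // ?D ?IH1 ?mul0n ?addn0 //.
move=> z zX zx; have [->//|zy] := eqVneq z y; exact: nxz.
Qed.

End Growth.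

(** * Connected graphs with few edges *)

Section Connected.
Context {V : finType} (e : rel V).
Hypotheses (esym : symmetric e) (eirr : irreflexive e).
Hypothesis (econ : forall x y, connect e x y).
Implicit Types (S X : {set V}) (x y u v : V).

Lemma connected_closed S x : x \in S ->
  (forall y z, y \in S -> e y z -> z \in S) -> forall z, z \in S.
Proof.
move=> xS cl z; have cS : closed e (mem S).
  by move=> y t eyt; apply/idP/idP => ?; apply: cl eyt || (apply: cl; [|rewrite esym; exact: eyt]).
by rewrite -(closed_connect cS (econ x z)).
Qed.

Lemma exit_edge S x z : x \in S -> z \notin S ->
  exists u v, [/\ u \notin S, v \in S & e u v].
Proof.
move=> xS zS; have [|none] := boolP [exists u, exists v, [&& u \notin S, v \in S & e u v]].
  by case/existsP => u /existsP[v /and3P[? ? ?]]; exists u, v.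
case/negP: zS; apply: (connected_closed xS) => v u vS evu.
apply: contraNT none => uS; apply/existsP; exists u; apply/existsP; exists v.
by rewrite uS vS esym.
Qed.

Lemma nbrs_gt0_connected x z : x != z -> 0 < nbrs e setT x.
Proof.
move=> xz; have [||u [v [uS vS euv]]] := @exit_edge [set x] x z; rewrite ?inE 1?eq_sym //.
move: vS uS; rewrite !inE => /eqP <- _.
by apply: (nbrs_gt0 (y := u)); rewrite ?inE // esym.
Qed.

(** By connectedness the outside of [S] can be absorbed one vertex at a time, each vertex bringing
    at least one new edge, hence two arcs. *)
Lemma arcs_growth S x : x \in S -> arcs e S + 2 * #|~: S| <= arcs e setT.
Proof.
have [k] := ubnP #|~: S|; elim: k S => // k IH S lk xS.
have [->|] := eqVneq S setT; first by rewrite setCT cards0 addn0.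
rewrite eqEsubset subsetT => /subsetPn[z _ zS].
have [u [v [uS vS euv]]] := exit_edge xS zS.
have cU : #|~: S| = #|~: (u |: S)|.+1.
  rewrite (cardsD1 u) inE uS add1n; congr _.+1; apply: eq_card => y.
  by rewrite !inE negb_or.
have := IH (u |: S); rewrite arcs_setU1 // inE xS orbT.
have := nbrs_gt0 vS euv; lia.
Qed.

Section Tree.
Hypothesis few : arcs e setT <= 2 * #|V| - 1.

Lemma arcs_le S x : x \in S -> arcs e S + 1 <= 2 * #|S|.
Proof.
move=> xS; have := arcs_growth xS; have := cardsC S.
have : 0 < #|S| by apply/card_gt0P; exists x.
lia.
Qed.

(** [n_edges] rounds when it halves, so [few] tolerates one arc beyond the exact count. Parity
    absorbs it: [2 * nbrs e S u] is at most 3, so the exit edge is the only edge from [u] to [S]. *)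
Lemma tree_growth S x z : x \in S -> z \notin S -> arcs e S = 2 * #|S| - 2 ->
  exists u v, [/\ u \notin S, v \in S, e u v, nbrs e S u = 1
   & arcs e (u |: S) = 2 * #|u |: S| - 2].
Proof.
move=> xS zS aS; have [u [v [uS vS euv]]] := exit_edge xS zS.
have := arcs_setU1 esym eirr uS; have := cardsU1 u S; rewrite uS.
have := @arcs_le (u |: S) u (setU11 _ _); have := nbrs_gt0 vS euv.
have : 0 < #|S| by apply/card_gt0P; exists x.
move=> *; exists u, v; split=> //; lia.
Qed.

End Tree.
End Connected.

(** * Trees containing a path on six vertices *)

Lemma sum_set_seq (V : finType) (l : seq V) (F : V -> nat) : uniq l ->
  \sum_(x in [set x in l]) F x = \sum_(x <- l) F x.
Proof. by move=> ul; rewrite big_uniq //; apply: eq_bigl => x; rewrite inE. Qed.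

Lemma nbrs_seq (V : finType) (e : rel V) (l : seq V) x : uniq l ->
  nbrs e [set x in l] x = \sum_(y <- l) e x y.
Proof. exact: sum_set_seq. Qed.

Lemma arcs_seq (V : finType) (e : rel V) (l : seq V) : uniq l ->
  arcs e [set x in l] = \sum_(x <- l) \sum_(y <- l) e x y.
Proof.
move=> ul; rewrite /arcs sum_set_seq //.
by apply: eq_bigr => x _; rewrite nbrs_seq.
Qed.

Lemma card_set_of_seq (V : finType) (l : seq V) : uniq l -> #|[set x in l]| = size l.
Proof. by move=> ul; rewrite cardsE; apply/card_uniqP. Qed.

Definition colored (V : finType) (c : V -> bool) (S : {set V}) (b : bool) : nat :=
  \sum_(x in S) (c x == b).

Section LongTree.
Context {V : finType} (e : rel V) (c : V -> bool).
Hypotheses (esym : symmetric e) (eirr : irreflexive e).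
Hypothesis (econ : forall x y, connect e x y).
Hypothesis few : arcs e setT <= 2 * #|V| - 1.
Hypothesis proper : forall x y, e x y -> c x != c y.
Implicit Types (S X : {set V}) (x y u v : V).

(* Invariant of subtrees containing an induced path on six vertices. The last
   clause says that the permanent exceeds both bounds
   [(2n-3)(6m-5)+3] and [(2m-3)(6n-5)+3], the third that deleting a vertex on
   the side of size [n] leaves at least [6n-5]. *)
Record long (S : {set V}) : Prop := Long {
  long_arcs : arcs e S = 2 * #|S| - 2;
  long_nbrs x : x \in S -> 0 < nbrs e S x;
  long_del x : x \in S -> 6 * colored c S (c x) <= wper (nbrs e S) e (S :\ x) + 5;
  long_inner b : exists x y, [/\ x \in S, y \in S, x != y, c x = b & c y = b]
    /\ 2 <= nbrs e S x /\ 2 <= nbrs e S y;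
  long_colored b : 3 <= colored c S b;
  long_per b : 12 * colored c S b * colored c S (~~ b) + 19 <=
    wper (nbrs e S) e S + 10 * colored c S b + 18 * colored c S (~~ b) }.

Lemma colored_setU1 S u b : u \notin S ->
  colored c (u |: S) b = (c u == b) + colored c S b.
Proof. by move=> uS; rewrite /colored big_setU1. Qed.

(** The identity permutation contributes the product of the degrees. In each colour class a vertex
    of degree at least 2 survives the deletion, and all other factors are positive. *)
Lemma long_del2 S x y : long S -> x \in S -> y \in S -> c x != c y ->
  4 <= wper (nbrs e S) e (S :\ x :\ y).
Proof.
move=> lS xS yS cxy; apply: leq_trans (wper_ge_prod _ _ _).
have inner z : exists t, [/\ t \in S, t != z, c t = c z & 2 <= nbrs e S t].
  have [t1 [t2 [[t1S t2S t12 c1 c2] [n1 n2]]]] := long_inner lS (c z).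
  have [zt|zt] := eqVneq t1 z; last by exists t1.
  by exists t2; split=> //; rewrite -zt eq_sym.
have [s [sS sx cs ns]] := inner x; have [t [tS ty ct nt]] := inner y.
have sy : s != y by apply: contra cxy => /eqP <-; rewrite cs.
have tx : t != x by apply: contra cxy => /eqP <-; rewrite ct.
have ts : t != s by apply: contra cxy => /eqP ts; rewrite -cs -ct ts.
rewrite (big_setD1 s) ?inE ?sx ?sy ?sS //= (big_setD1 t) ?inE ?ts ?ty ?tx ?tS //=.
rewrite mulnA -[4]/(2 * 2 * 1) leq_mul ?leq_mul //.
rewrite prodn_cond_gt0 // => z; rewrite !inE => /and5P[_ _ _ _ zS].
exact: (long_nbrs lS).
Qed.

(** The clauses support each other: [long_per] grows by twice a value bounded by [long_del], and
    [long_del] at the new leaf follows from [long_per]. At an old vertex on the side of [u] the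
    requirement rises by 6, while [long_del2] supplies 8; on the other side the requirement does not
    rise. *)
Lemma long_leaf S u v : long S -> u \notin S -> v \in S -> e u v -> nbrs e S u = 1 ->
  arcs e (u |: S) = 2 * #|u |: S| - 2 -> long (u |: S).
Proof.
move=> lS uS vS euv uS1 aU.
have cuv : c v = ~~ c u by have := proper euv; case: (c u); case: (c v).
have perU := wper_leaf esym eirr uS vS euv uS1 (subxx S).
have delv := long_del lS vS.
have pern := long_per lS.
have cS := long_colored lS.
split=> //.
- move=> x; rewrite nbrs_setU1 // !inE => /orP[/eqP->|xS]; first by rewrite eirr uS1.
  by rewrite addn_gt0 (long_nbrs lS) ?orbT.
- move=> x; rewrite !inE colored_setU1 // => /orP[/eqP->|xS].
    rewrite setU1K // (wper_leaf_degree esym uS vS euv uS1 (subxx S)) vS eqxx mul1n.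
    have := pern (c u); have := cS (c u); have := cS (~~ c u).
    move: (colored _ _ _) (colored _ _ _) (wper _ _ _) (wper _ _ _) => m n f g; nia.
  have xu : x != u by apply: contraNneq uS => <-.
  have -> : (u |: S) :\ x = u |: (S :\ x).
    by apply/setP => z; rewrite !inE; have [->|] := eqVneq z u; rewrite ?andbT // eq_sym.
  rewrite (wper_leaf esym eirr uS vS euv uS1 (subsetDl _ _)) !inE vS andbT.
  have := long_del lS xS.
  have [cux|cux] := eqVneq (c u) (c x); last by lia.
  have cxv : c x != c v by rewrite -cux cuv; case: (c u).
  have -> : v != x by apply: contraNneq cxv => ->.
  have := long_del2 lS xS vS cxv; lia.
- move=> b; have [x [y [[xS yS xy cx cy] [nx ny]]]] := long_inner lS b.
  exists x, y; rewrite !inE xS yS !orbT; split=> //.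
  by split; apply: leq_trans (nbrs_sub _ _ (subsetU1 u S)).
- by move=> b; rewrite colored_setU1 //; have := cS b; lia.
move=> b; rewrite !colored_setU1 // perU vS muln1.
rewrite cuv in delv; have := pern b.
(* Let [n] be the size of the class of [v]. If [b] is the colour of [u], the required increment
   [12n-10] is exactly twice the bound at [v]; for the other colour it is only [12n-18]. *)
have [cb|cb] := eqVneq (c u) b.
  move: delv; rewrite cb; have -> : (b == ~~ b) = false by case: (b).
  move: (colored _ _ _) (colored _ _ _) (wper _ _ _) (wper _ _ _) => m n f g; nia.
have -> : c u == ~~ b by move: cb; clear; case: (c u); case: b.
have {cb} -> : b = ~~ c u by move: cb; clear; case: (c u); case: b.
rewrite negbK.
move: delv; move: (colored _ _ _) (colored _ _ _) (wper _ _ _) (wper _ _ _) => m n f g; nia.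
Qed.

Lemma long_setT S x : x \in S -> long S -> long setT.
Proof.
have [k] := ubnP #|~: S|; elim: k S => // k IH S lk xS lS.
have [<-//|] := eqVneq S setT.
rewrite eqEsubset subsetT => /subsetPn[z _ zS].
have [u [v [uS vS euv uS1 aU]]] := tree_growth esym eirr econ few xS zS (long_arcs lS).
apply: (IH (u |: S)); [|by rewrite inE xS orbT|exact: long_leaf lS uS vS euv uS1 aU].
move: lk; rewrite (cardsD1 u (~: S)) inE uS add1n ltnS; apply: leq_trans.
rewrite ltnS subset_leq_card //.
by apply/subsetP => y; rewrite !inE negb_or.
Qed.

(** A square would carry 8 arcs on four vertices, one more than [arcs_le] allows. *)
Lemma no_square x0 x1 x2 x3 : e x0 x1 -> e x1 x2 -> e x2 x3 -> x0 != x2 -> x1 != x3 ->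
  ~~ e x3 x0.
Proof.
move=> e01 e12 e23 n02 n13; apply/negP => e30.
have ne x y : e x y -> x != y by apply: contraTneq => ->; rewrite eirr.
have u4 : uniq [:: x0; x1; x2; x3].
  by rewrite /= !inE !negb_or n02 n13 (ne x0 x1) // (ne x1 x2) // (ne x2 x3) // eq_sym (ne x3 x0).
have := @arcs_le _ _ esym eirr econ few [set x in [:: x0; x1; x2; x3]] x0.
rewrite arcs_seq // card_set_of_seq // !inE eqxx !big_cons !big_nil.
rewrite !eirr e01 e12 e23 e30 (esym x1 x0) e01 (esym x2 x1) e12 (esym x3 x2) e23.
by rewrite (esym x0 x3) e30 (esym x2 x0) (esym x3 x1) => /(_ isT) /=; lia.
Qed.

Lemma long_path x0 x1 x2 x3 x4 x5 :
  e x0 x1 -> e x1 x2 -> e x2 x3 -> e x3 x4 -> e x4 x5 ->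
  x0 != x2 -> x1 != x3 -> x2 != x4 -> x3 != x5 -> long [set x in [:: x0; x1; x2; x3; x4; x5]].
Proof.
move=> e01 e12 e23 e34 e45 n02 n13 n24 n35.
have nc x y : c x != c y -> x != y by apply: contraNneq => ->.
have ec x y : c x = c y -> e x y = false.
  by move=> cxy; apply/negP => /proper; rewrite cxy eqxx.
have step x y : e x y -> c y = ~~ c x by move/proper; case: (c x); case: (c y).
have c1 := step _ _ e01; have c2 := step _ _ e12; have c3 := step _ _ e23.
have c4 := step _ _ e34; have c5 := step _ _ e45.
rewrite c1 negbK in c2; rewrite c2 in c3; rewrite c3 negbK in c4; rewrite c4 in c5.
(* A coincidence of vertices four steps apart would close a square. *)
have n04 : x0 != x4.
  by apply: contraTneq e34 => <-; apply: no_square e01 e12 e23 n02 n13.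
have n15 : x1 != x5.
  by apply: contraTneq e45 => <-; apply: no_square e12 e23 e34 n13 n24.
have n01 : x0 != x1 by apply: nc; rewrite c1; case: (c x0).
have n03 : x0 != x3 by apply: nc; rewrite c3; case: (c x0).
have n05 : x0 != x5 by apply: nc; rewrite c5; case: (c x0).
have n12 : x1 != x2 by apply: nc; rewrite c2 c1; case: (c x0).
have n14 : x1 != x4 by apply: nc; rewrite c4 c1; case: (c x0).
have n23 : x2 != x3 by apply: nc; rewrite c3 c2; case: (c x0).
have n25 : x2 != x5 by apply: nc; rewrite c5 c2; case: (c x0).
have n34 : x3 != x4 by apply: nc; rewrite c4 c3; case: (c x0).
have n45 : x4 != x5 by apply: nc; rewrite c5 c4; case: (c x0).
have uQ : uniq [:: x0; x1; x2; x3; x4; x5].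
  by rewrite /= !inE !negb_or n01 n02 n03 n04 n05 n12 n13 n14 n15 n23 n24 n25 n34 n35 n45.
have e02 : e x0 x2 = false by apply: ec; rewrite c2.
have e04 : e x0 x4 = false by apply: ec; rewrite c4.
have e24 : e x2 x4 = false by apply: ec; rewrite c2 c4.
have e13 : e x1 x3 = false by apply: ec; rewrite c1 c3.
have e15 : e x1 x5 = false by apply: ec; rewrite c1 c5.
have e35 : e x3 x5 = false by apply: ec; rewrite c3 c5.
have x0Q : x0 \in [set x in [:: x0; x1; x2; x3; x4; x5]] by rewrite inE mem_head.
have aQ := arcs_le esym eirr econ few x0Q.
have dE := (eirr, e01, e12, e23, e34, e45, e02, e04, e24, e13, e15, e35,
  esym x1 x0, esym x2 x1, esym x3 x2, esym x4 x3, esym x5 x4,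
  esym x2 x0, esym x4 x0, esym x4 x2, esym x3 x1, esym x5 x1, esym x5 x3,
  esym x3 x0, esym x5 x0, esym x4 x1, esym x5 x2).
rewrite arcs_seq // card_set_of_seq // !big_cons !big_nil !dE in aQ.
(* The path accounts for 10 arcs and six vertices carry at most 11, so there is no room for a chord,
   which would add 2. *)
have /and4P[/negPf e03 /negPf e05 /negPf e14 /negPf e25] :
    [&& ~~ e x0 x3, ~~ e x0 x5, ~~ e x1 x4 & ~~ e x2 x5].
  by move: aQ; case: (e x0 x3); case: (e x0 x5); case: (e x1 x4); case: (e x2 x5).
set Q := [set x in _]; set l := [:: x0; x1; x2; x3; x4; x5] in Q uQ *.
have d0 : nbrs e Q x0 = 1 by rewrite nbrs_seq // !big_cons big_nil !(dE, e03, e05, e14, e25).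
have d1 : nbrs e Q x1 = 2 by rewrite nbrs_seq // !big_cons big_nil !(dE, e03, e05, e14, e25).
have d2 : nbrs e Q x2 = 2 by rewrite nbrs_seq // !big_cons big_nil !(dE, e03, e05, e14, e25).
have d3 : nbrs e Q x3 = 2 by rewrite nbrs_seq // !big_cons big_nil !(dE, e03, e05, e14, e25).
have d4 : nbrs e Q x4 = 2 by rewrite nbrs_seq // !big_cons big_nil !(dE, e03, e05, e14, e25).
have d5 : nbrs e Q x5 = 1 by rewrite nbrs_seq // !big_cons big_nil !(dE, e03, e05, e14, e25).
have colQ b : colored c Q b = 3.
  rewrite /colored sum_set_seq // !big_cons big_nil c1 c2 c3 c4 c5.
  by case: (c x0); case: b.
(* With three vertices of each colour [long_per] asks for 43. *)
have perQ : wper (nbrs e Q) e Q = 58.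
  by rewrite wper_path //= ?d0 ?d1 ?d2 ?d3 ?d4 ?d5 ?(dE, e03, e05, e14, e25).
have neq x y : x != y -> (x == y) = false by move/negPf.
have nE := (neq _ _ n01, neq _ _ n02, neq _ _ n03, neq _ _ n04, neq _ _ n05, neq _ _ n12,
  neq _ _ n13, neq _ _ n14, neq _ _ n15, neq _ _ n23, neq _ _ n24, neq _ _ n25,
  neq _ _ n34, neq _ _ n35, neq _ _ n45).
have delQ x : x \in l -> wper (nbrs e Q) e (Q :\ x) = continuant e (nbrs e Q) (rem x l).
  move=> xl; have -> : Q :\ x = [set y in rem x l].
    by apply/setP => y; rewrite in_setD1 /Q !in_set mem_rem_uniq // inE.
  rewrite wper_path ?rem_uniq //.
  move: xl; rewrite !inE => /or4P[/eqP->|/eqP->|/eqP->|/or3P[]/eqP->];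
  by rewrite /l /= ?(eqxx, nE) /= ?(dE, e03, e05, e14, e25).
split.
- rewrite arcs_seq // card_set_of_seq // !big_cons !big_nil.
  by rewrite !(dE, e03, e05, e14, e25).
- move=> x; rewrite inE /l !inE => /or4P[/eqP->|/eqP->|/eqP->|/or3P[]/eqP->];
  by rewrite ?d0 ?d1 ?d2 ?d3 ?d4 ?d5.
- move=> x; rewrite inE => xl; rewrite colQ delQ //.
  move: xl; rewrite !inE => /or4P[/eqP->|/eqP->|/eqP->|/or3P[]/eqP->];
  by rewrite /l /= ?(eqxx, nE) /= ?d0 ?d1 ?d2 ?d3 ?d4 ?d5 ?(dE, e03, e05, e14, e25).
- move=> b; have [cb|cb] := eqVneq (c x0) b.
    exists x2, x4; rewrite d2 d4 !inE !eqxx !orbT; split=> //.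
    by rewrite n24 c2 c4 cb.
  exists x1, x3; rewrite d1 d3 !inE !eqxx !orbT; split=> //.
  by rewrite n13 c1 c3; move: cb; case: (c x0); case: b.
- by move=> b; rewrite colQ.
by move=> b; rewrite !colQ perQ.
Qed.

End LongTree.

(** * Spiders *)

Section Neighbours.
Context {V : finType} (e : rel V).
Implicit Types (S : {set V}) (x y z : V).

Lemma nbrs_card S x : nbrs e S x = #|[set y in S | e x y]|.
Proof.
rewrite /nbrs -sum1dep_card big_mkcondr /=.
by apply: eq_bigr => y _; case: (e x y).
Qed.

Lemma nbrs_le1 S x y z : nbrs e S x <= 1 -> y \in S -> z \in S -> e x y -> e x z -> y = z.
Proof.
rewrite nbrs_card => /card_le1_eqP H yS zS exy exz.
by apply: H; rewrite inE ?yS ?zS.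
Qed.

Lemma nbrs_ge2 S x y : 2 <= nbrs e S x -> exists z, [/\ z \in S, z != y & e x z].
Proof.
rewrite nbrs_card => /card_gt1P[s [t [+ + st]]]; rewrite !inE => /andP[sS es] /andP[tS et].
have [sy|] := eqVneq s y; last by exists s.
by exists t; split=> //; rewrite -sy eq_sym.
Qed.

End Neighbours.

(* [par x] is the neighbour of [x] towards the centre [w], and [par w = w]. *)
Definition spider (V : finType) (e : rel V) (par : V -> V) (w : V) : Prop :=
  (forall x, par (par x) = w) /\
  (forall x y, e x y = (x != y) && ((par x == y) || (par y == x))).

(** * The dichotomy between spiders and trees with a long path *)

Section ColoredTree.
Context {V : finType} (e : rel V) (c : V -> bool).
Hypotheses (esym : symmetric e) (eirr : irreflexive e).
Hypothesis (econ : forall x y, connect e x y).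
Hypothesis proper : forall x y, e x y -> c x != c y.
Implicit Types (x y a w : V).

(** If every vertex two steps from [a] were a leaf, then [a] with its first two neighbourhoods would
    be closed under adjacency and contain [a'], which by its colour would be one of these leaves. So
    [a'] can be traded for a non-leaf exactly two steps away. *)
Lemma second_step a a' : a != a' -> c a = c a' -> 2 <= nbrs e setT a' ->
  exists y x, [/\ e a y, e y x, x != a & 2 <= nbrs e setT x].
Proof.
move=> aa' caa' na'.
have [|none] := boolP [exists y, exists x, [&& e a y, e y x, x != a & 2 <= nbrs e setT x]].
  by case/existsP => y /existsP[x /and4P[? ? ? ?]]; exists y, x.
have leaf y x : e a y -> e y x -> x != a -> nbrs e setT x <= 1.
  move=> ay yx xa; rewrite leqNgt; apply: contra none => nx.
  by apply/existsP; exists y; apply/existsP; exists x; rewrite ay yx xa.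
pose C := [set z | [|| z == a, e a z | [exists y, e a y && e y z]]].
have aC : a \in C by rewrite inE eqxx.
have := connected_closed esym econ aC _ a'; rewrite inE eq_sym (negPf aa') /=.
have /negPf -> : ~~ e a a' by apply/negP => /proper; rewrite caa' eqxx.
move=> /= H; have /existsP[y /andP[ay ya']] : [exists y, e a y && e y a'].
  apply: H => z t; rewrite !inE => /or3P[/eqP->|az|/existsP[y /andP[ay yz]]] zt.
  - by rewrite zt orbT.
  - by apply/or3P/Or33/existsP; exists z; rewrite az.
  have [za|za] := eqVneq z a; first by rewrite -za zt orbT.
  have zy : e z y by rewrite esym.
  by rewrite -(nbrs_le1 (leaf _ _ ay yz za) (in_setT _) (in_setT _) zy zt) ay orbT.
by have := leaf y a' ay ya'; rewrite eq_sym aa' => /(_ isT); lia.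
Qed.

(** Two non-leaves of one colour are found around a common neighbour [b1], then a second non-leaf
    [b2] of the other colour two steps from [b1] through [a3]. Extending at both ends gives the path
    [b0 a4 b1 a3 b2 a5]. *)
Lemma long_tree : arcs e setT <= 2 * #|V| - 1 ->
  (forall b w, c w = b -> exists x, [/\ c x = b, x != w & 2 <= nbrs e setT x]) ->
  (exists x y : V, c x != c y) -> long e c setT.
Proof.
move=> few inner [x [y cxy]].
have both b : exists z, c z = b.
  have [<-|xb] := eqVneq (c x) b; first by exists x.
  by exists y; move: cxy xb; case: (c x); case: (c y); case: b.
have [a0 ca0] := both true; have [a [ca _ na]] := inner true a0 ca0.
have [a1 [ca1 a1a na1]] := inner true a ca.
have [|||b1 [a2 [ab1 b1a2 a2a na2]]] := @second_step a a1; rewrite ?ca ?ca1 1?eq_sym //.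
have cb1 : c b1 = false by move/proper: ab1; rewrite ca; case: (c b1).
have [b' [cb' b'b1 nb']] := inner false b1 cb1.
have [|||a3 [b2 [b1a3 a3b2 b2b1 nb2]]] := @second_step b1 b'; rewrite ?cb1 ?cb' 1?eq_sym //.
(* Of the two non-leaves [a] and [a2] adjacent to [b1], at least one differs from [a3]. *)
have [a4 [b1a4 a4a3 na4]] : exists a4, [/\ e b1 a4, a4 != a3 & 2 <= nbrs e setT a4].
  have [aa3|aa3] := eqVneq a a3; last by exists a; rewrite esym.
  by exists a2; rewrite -aa3.
have [b0 [_ b0b1 a4b0]] := nbrs_ge2 b1 na4.
have [a5 [_ a5a3 b2a5]] := nbrs_ge2 a3 nb2.
apply: (@long_setT _ e c esym eirr econ few proper _ b0); last first.
  apply: (long_path esym eirr econ few proper (x0 := b0) (x1 := a4) (x2 := b1) (x3 := a3)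
    (x4 := b2) (x5 := a5)); rewrite // 1?esym // 1?eq_sym //.
by rewrite inE mem_head.
Qed.

(** A vertex [b] of the other colour not adjacent to [w] would have only leaves as neighbours, and
    would form with them a set closed under adjacency that misses [w]. Hence every such [b] is
    adjacent to [w], and the vertices coloured like [w] are leaves hanging at such [b]. *)
Lemma spider_tree w :
  (forall x, c x = c w -> x != w -> nbrs e setT x = 1) -> exists par, spider e par w.
Proof.
move=> leaf; pose nb x := odflt w [pick y | e x y].
have nbP x : c x = c w -> x != w -> e x (nb x).
  move=> cx xw; rewrite /nb; case: pickP => [y //|none].
  by have := leaf x cx xw; rewrite /nbrs big1 // => y _; rewrite none.
have one x y z : c x = c w -> x != w -> e x y -> e x z -> y = z.
  move=> cx xw; apply: (@nbrs_le1 _ e setT x); rewrite ?leaf ?in_setT //.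
have hub b : c b != c w -> e b w.
  move=> cb; have bC : b \in [set z | (z == b) || e b z] by rewrite inE eqxx.
  have := connected_closed esym econ bC _ w; rewrite inE eq_sym.
  have [bw|_] := eqVneq b w; first by rewrite bw eqxx in cb.
  move=> /= H; have [//|nbw] := boolP (e b w); rewrite -(negPf nbw); apply: H.
  move=> z t; rewrite !inE => /orP[/eqP->|bz] zt; first by rewrite zt orbT.
  have cz : c z = c w by move/proper: bz; move: cb; case: (c b); case: (c z); case: (c w).
  have zw : z != w by apply: contra nbw => /eqP <-.
  have zb : e z b by rewrite esym.
  by rewrite -(one z b t cz zw zb zt) eqxx.
pose par x := if (c x == c w) && (x != w) then nb x else w.
have parw : par w = w by rewrite /par !eqxx.
have par_other x : c x != c w -> par x = w by rewrite /par => /negPf->.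
exists par; split=> [x|x y].
  rewrite {2}/par; case: ifP => [/andP[/eqP cx xw]|_]; last exact: parw.
  by apply: par_other; rewrite -cx eq_sym; apply: proper; exact: nbP.
have par_adj z : z != par z -> e z (par z).
  rewrite /par; have [cz|cz _] /= := eqVneq (c z) (c w); last exact: hub.
  by have [->|zw _] /= := eqVneq z w; [rewrite eqxx|exact: nbP].
apply/idP/andP => [exy|[xy /orP[]/eqP pxy]]; last 2 first.
- by rewrite -pxy par_adj // pxy.
- by rewrite esym -pxy par_adj // pxy eq_sym.
have xy : x != y by apply: contraTneq exy => ->; rewrite eirr.
split=> //.
wlog cx : x y exy xy / c x = c w.
  move=> W; have [/W -> //|cx] := eqVneq (c x) (c w).
  rewrite orbC W // 1?esym // 1?eq_sym //.
  by move/proper: exy; move: cx; case: (c x); case: (c y); case: (c w).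
have [xw|xw] := eqVneq x w.
  by rewrite (par_other y) ?xw ?eqxx ?orbT // -cx eq_sym proper.
by rewrite /par cx eqxx xw /= (one _ _ _ cx xw (nbP x cx xw) exy) eqxx.
Qed.

End ColoredTree.

(** * Expanding the permanent along the branches of a spider *)

Section Star.
Context {V : finType} (d : V -> nat) (e : rel V).
Hypothesis esym : symmetric e.
Implicit Types (X L : {set V}) (x y b w : V).

Lemma wper_isolated_set X L : L \subset X -> {in L, forall x, d x = 1} ->
  {in L & X, forall x y, ~~ e x y} -> wper d e X = wper d e (X :\: L).
Proof.
have [k] := ubnP #|L|; elim: k X L => // k IH X L lk LX dL eL.
have [->|[x xL]] := set_0Vmem L; first by rewrite setD0.
rewrite (@wper_isolated _ _ _ _ x) ?(subsetP LX) //; last by move=> y yX _; apply: eL.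
rewrite dL // mul1n (IH _ (L :\ x)).
- by congr wper; apply/setP => y; rewrite !inE; have [->|] := eqVneq y x; rewrite ?xL.
- by move: lk; rewrite (cardsD1 x L) xL.
- exact: setSD.
- by move=> y; rewrite !inE => /andP[_ /dL].
- by move=> y z; rewrite !inE => /andP[_ yL] /andP[_ zX]; apply: eL.
Qed.

(** A contributing permutation either fixes all leaves of [b] or swaps [b] with one of them; the
    other leaves are then isolated and contribute factors 1. *)
Lemma wper_star X L b : L \subset X -> b \in X -> b \notin L -> {in L, forall x, d x = 1} ->
  {in L & X, forall x y, e x y = (y == b)} ->
  wper d e X = wper d e (X :\: L) + #|L| * wper d e (X :\: L :\ b).
Proof.
have [k] := ubnP #|L|; elim: k X L => // k IH X L lk LX bX bL dL eL.
have [->|[x xL]] := set_0Vmem L; first by rewrite setD0 cards0 addn0.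
have xX := subsetP LX x xL.
have xb : x != b by apply: contraNneq bL => <-.
rewrite (@wper_pendant _ _ _ _ x b) ?eL //; last first.
  by move=> y yX _ yb; rewrite eL.
rewrite dL // mul1n (IH _ (L :\ x)); first last.
- by move=> y z; rewrite !inE => /andP[_ yL] /andP[_ zX]; apply: eL.
- by move=> y; rewrite !inE => /andP[_ /dL].
- by rewrite !inE (negPf bL) andbF.
- by rewrite !inE eq_sym xb.
- exact: setSD.
- by move: lk; rewrite (cardsD1 x L) xL.
rewrite (@wper_isolated_set (X :\ x :\ b) (L :\ x)); first last.
- by move=> y z; rewrite !inE => /andP[_ yL] /and3P[zb _ zX]; rewrite eL.
- by move=> y; rewrite !inE => /andP[_ /dL].
- apply/subsetP => y; rewrite !inE => /andP[-> yL]; rewrite (subsetP LX _ yL) !andbT.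
  by apply: contraNneq bL => <-.
have -> : (X :\ x) :\: (L :\ x) = X :\: L.
  by apply/setP => y; rewrite !inE; have [->|] := eqVneq y x; rewrite ?xL.
have -> : (X :\ x :\ b) :\: (L :\ x) = X :\: L :\ b.
  apply/setP => y; rewrite !inE; have [->|] := eqVneq y x; rewrite ?xL ?andbF //.
  by rewrite /= andbCA.
by rewrite (cardsD1 x L) xL; lia.
Qed.

(** Stripped of its leaves, [b] is pendant at [w], or isolated when [w] is not in [X]. In a spider
    [d b = #|L| + 1], which produces the factor [2c+1]. *)
Lemma wper_branch X L b w : L \subset X -> b \in X -> b \notin L -> w \notin L -> b != w ->
  {in L, forall x, d x = 1} -> {in L & X, forall x y, e x y = (y == b)} ->
  {in X :\: L, forall y, e b y = (y == w)} ->
  wper d e X = (d b + #|L|) * wper d e (X :\: L :\ b) +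
               (w \in X) * wper d e (X :\: L :\ b :\ w).
Proof.
move=> LX bX bL wL bw dL eL eb; rewrite (wper_star LX bX bL dL eL).
have bX' : b \in X :\: L by rewrite inE bL.
have [wX|wX] := boolP (w \in X).
  have wX' : w \in X :\: L by rewrite inE wL.
  rewrite (@wper_pendant _ _ _ _ b w) ?eb //; last by move=> y yX _ yw; rewrite eb.
  lia.
rewrite (@wper_isolated _ _ _ _ b) //; first by lia.
move=> y yX yb; rewrite eb //; apply: contraNneq wX => <-.
by move: yX; rewrite inE => /andP[].
Qed.

End Star.

Fixpoint spider_prod (l : seq nat) : nat :=
  if l is c :: l' then (2 * c + 1) * spider_prod l' else 1.

Fixpoint spider_sum (l : seq nat) : nat :=
  if l is c :: l' then (2 * c + 1) * spider_sum l' + spider_prod l' else 0.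

Definition kids (V : finType) (par : V -> V) (b : V) : nat := #|[set x | par x == b]|.

Section Spider.
Context {V : finType} (e : rel V) (par : V -> V) (w : V).
Hypothesis sp : spider e par w.
Implicit Types (x y b : V).

Let par2 x : par (par x) = w. Proof. exact: sp.1. Qed.
Let eE x y : e x y = (x != y) && ((par x == y) || (par y == x)). Proof. exact: sp.2. Qed.

Lemma spider_parw : par w = w.
Proof. by have := par2 (par w); rewrite (par2 w). Qed.

Lemma spider_sym : symmetric e.
Proof. by move=> x y; rewrite !eE eq_sym orbC. Qed.

Lemma spider_leaf_adj x y : par x != w -> e x y = (y == par x).
Proof.
move=> xw; rewrite eE; apply/andP/eqP => [[_ /orP[/eqP->//|/eqP yx]]|->].
  by move: xw; rewrite -yx par2 eqxx.
rewrite eqxx; split=> //; apply: contra xw => /eqP xp.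
by rewrite -(par2 x) -xp -xp.
Qed.

Lemma spider_branch_adj b y : b != w -> par b = w -> e b y = (y == w) || (par y == b).
Proof.
move=> bw pb; rewrite eE pb (eq_sym w); apply: andb_idl.
case/orP => [/eqP-> //|/eqP yb].
by apply/eqP => E; move: bw; rewrite -pb E yb E eqxx.
Qed.

Lemma spider_hub_adj y : e w y = (y != w) && (par y == w).
Proof.
rewrite eE spider_parw eq_sym.
by case: (y == w).
Qed.

Definition spider_span (l : seq V) : {set V} := [set x | (x \in l) || (par x \in l)].

(** Branches are stripped one by one while [d] keeps the degrees of the whole tree, hence the free
    [d w]. The permanents with and without [w] go through one induction, because swapping [w] with a
    branch vertex removes [w] and leaves the product over the other branches. *)
Lemma spider_wper (d : V -> nat) (l : seq V) : uniq l ->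
  {in l, forall b, [&& b != w, par b == w & d b == kids par b + 1]} ->
  (forall x, par x \in l -> d x = 1) ->
  wper d e (spider_span l) = spider_prod [seq kids par b | b <- l] /\
  wper d e (w |: spider_span l) = d w * spider_prod [seq kids par b | b <- l]
    + spider_sum [seq kids par b | b <- l].
Proof.
elim: l => [_ _ _|b l IH /= /andP[bl ul] Hl dl].
  have -> : spider_span [::] = set0 by apply/setP => x; rewrite !inE.
  rewrite wper_set0 setU0; split=> //.
  rewrite (@wper_isolated _ _ _ _ w) ?set11 //; last by move=> y; rewrite !inE => ->.
  by rewrite setDv wper_set0 addn0.
have /and3P[bw /eqP pb /eqP db] := Hl b (mem_head _ _).
have Hl' : {in l, forall b, [&& b != w, par b == w & d b == kids par b + 1]}.
  by move=> x xl; apply: Hl; rewrite inE xl orbT.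
have [|IH1 IH2] := IH ul Hl'; first by move=> x xl; apply: dl; rewrite inE xl orbT.
have wl : w \notin l by apply/negP => /Hl' /and3P[]; rewrite eqxx.
have pw := spider_parw.
set L := [set x | par x == b].
have cL : #|L| = kids par b by [].
have bL : b \notin L by rewrite inE pb eq_sym.
have wL : w \notin L by rewrite inE pw eq_sym.
have dL : {in L, forall x, d x = 1}.
  by move=> x; rewrite inE => /eqP xb; apply: dl; rewrite xb mem_head.
have eL (X : {set V}) : {in L & X, forall x y, e x y = (y == b)}.
  by move=> x y; rewrite inE => /eqP xb _; rewrite spider_leaf_adj ?xb.
have eb (X : {set V}) : {in X :\: L, forall y, e b y = (y == w)}.
  by move=> y; rewrite !inE => /andP[/negPf yb _]; rewrite spider_branch_adj // yb orbF.
have Lspan : L \subset spider_span (b :: l).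
  by apply/subsetP => x; rewrite !inE => ->; rewrite orbT.
have bspan : b \in spider_span (b :: l) by rewrite !inE eqxx.
have wspan s : w \notin s -> w \notin spider_span s by rewrite inE pw orbb.
have wbl : w \notin b :: l by rewrite inE negb_or eq_sym bw.
have rest : spider_span (b :: l) :\: L :\ b = spider_span l.
  apply/setP => x; rewrite !inE; have [->|xb] := eqVneq x b.
    by rewrite (negPf bl) pb (negPf wl).
  rewrite /=; have [xb'|//] := eqVneq (par x) b.
  rewrite /= xb' (negPf bl) orbF; apply/esym/negP => /Hl' /and3P[_ /eqP xw _].
  by rewrite -xb' xw eqxx in bw.
have restw : (w |: spider_span (b :: l)) :\: L :\ b = w |: spider_span l.
  rewrite -rest; apply/setP => x; rewrite !inE.
  by have [->|] := eqVneq x w; rewrite ?pw ?(eq_sym w b) ?(negPf bw).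
have spb X LX bX := @wper_branch _ d e spider_sym X L b w LX bX bL wL bw dL (eL _) (eb _).
split.
  rewrite (spb _ Lspan bspan) rest (negPf (wspan _ wbl)) IH1 db cL mul0n addn0.
  by congr (_ * _); lia.
have Lspan' := subset_trans Lspan (subsetUr [set w] _).
have bspan' : b \in w |: spider_span (b :: l) by rewrite inE bspan orbT.
rewrite (spb _ Lspan' bspan') restw setU1K ?wspan // setU11 IH1 IH2 db cL; lia.
Qed.

Lemma nbrs_spider_leaf x : par x != w -> nbrs e setT x = 1.
Proof.
move=> xw; rewrite nbrs_card -(cards1 (par x)); apply: eq_card => y.
by rewrite !inE spider_leaf_adj.
Qed.

Lemma nbrs_spider_branch b : b != w -> par b = w -> nbrs e setT b = kids par b + 1.
Proof.
move=> bw pb; rewrite nbrs_card /kids addn1 -[in RHS]add1n.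
have wk : w \notin [set x | par x == b] by rewrite inE spider_parw eq_sym.
rewrite -[1]/(true : nat) -wk -cardsU1; apply: eq_card => y.
by rewrite !inE spider_branch_adj.
Qed.

Lemma nbrs_spider_hub (l : seq V) : uniq l -> (forall b, (b \in l) = (b != w) && (par b == w)) ->
  nbrs e setT w = size l.
Proof.
move=> ul lE; rewrite nbrs_card -(card_uniqP ul); apply: eq_card => y.
by rewrite !inE spider_hub_adj lE.
Qed.

Lemma spider_per (l : seq V) : uniq l -> (forall b, (b \in l) = (b != w) && (par b == w)) ->
  wper (nbrs e setT) e setT = size l * spider_prod [seq kids par b | b <- l]
    + spider_sum [seq kids par b | b <- l].
Proof.
move=> ul lE; rewrite -(nbrs_spider_hub ul lE).
have [||_ <-] := @spider_wper (nbrs e setT) l ul.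
- by move=> b; rewrite lE => /andP[bw /eqP pb]; rewrite bw pb eqxx nbrs_spider_branch /=.
- move=> x; rewrite lE => /andP[xw _]; exact: nbrs_spider_leaf.
congr wper; apply/setP => x; rewrite !inE !lE par2 eqxx andbT.
by case: (x == w); case: (par x == w).
Qed.

End Spider.

(** * Minimising the permanent of a spider *)

Definition positives (l : seq nat) : nat := count (fun c => 0 < c) l.

Definition spider_value (l : seq nat) : nat :=
  size l * spider_prod l + spider_sum l.

Lemma spider_flat l : positives l = 0 ->
  [/\ spider_prod l = 1, spider_sum l = size l & sumn l = 0].
Proof.
elim: l => //= -[|c] l IH; rewrite /positives /= => pl; last by lia.
by have [-> -> ->] := IH pl; split; lia.
Qed.

Lemma spider_star l : positives l = 1 ->
  [/\ spider_prod l = 2 * sumn l + 1, 0 < sumn l, 0 < size l, sumn l \in l &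
  spider_sum l + 2 * sumn l = size l * (2 * sumn l + 1)].
Proof.
elim: l => //= -[|c] l IH; rewrite /positives /= => pl.
  have [-> s0 l0 sl E] := IH pl; split=> //; first by lia.
    by rewrite add0n inE sl orbT.
  by rewrite mul1n add0n; nia.
have [|-> -> ->] := @spider_flat l; first by rewrite /positives; lia.
by rewrite addn0 inE eqxx; split=> //; lia.
Qed.

Lemma spider_value_cons c l :
  spider_value (c :: l) = (2 * c + 1) * spider_value l + (2 * c + 2) * spider_prod l.
Proof. rewrite /spider_value /=; nia. Qed.

(* With [s = p - 1] and [size l = q] the two alternatives are the exact value
   [(2p-3)(6q-5)+3] and an excess of at least [8(q-1)] over it, which is more
   than the gap [8(q-p)] to the other bound. *)
Lemma spider_value_ge l : 2 <= positives l ->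
  [/\ positives l = 2, 1 \in l, spider_prod l + 3 = 6 * sumn l &
      spider_value l + 10 * sumn l + 6 * size l = 12 * sumn l * size l + 8] \/
  6 * sumn l + 1 <= spider_prod l /\
  12 * sumn l * size l + 2 * size l <= spider_value l + 10 * sumn l.
Proof.
elim: l => //= c l IH; rewrite spider_value_cons => pl.
(* An empty branch keeps the product [P] and adds [2P] to the value: exactly [12s-6] in the first
   alternative and at least [12s+2] in the second, with [s] the sum. These are the changes of the
   two bounds when the size grows by one. *)
have [c0|c0] := posnP c.
  move: pl; rewrite c0 /positives /= => pl.
  have [[p2 l1 Pl fl]|[Pl fl]] := IH pl; [left|right].
    by split; rewrite ?inE ?l1 ?orbT //; nia.
  by split; nia.
have [p1|] := eqVneq (positives l) 1.
  have [Pl s0 q0 sl El] := spider_star p1.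
  have fl : spider_value l + 2 * sumn l = 2 * size l * (2 * sumn l + 1).
    by rewrite /spider_value Pl; nia.
  (* With [s] the single positive entry of [l], [(2c+1)(2s+1) + 3 - 6(c+s) = 4(c-1)(s-1)]. So the
     exact case occurs when [c] or [s] is 1, and otherwise the excess is at least 4. *)
  have [c1|c1] := eqVneq c 1.
    by left; rewrite p1 c1 inE eqxx Pl; split=> //; nia.
  have [s1|s1] := eqVneq (sumn l) 1.
    have l1 : 1 \in l by move: sl; rewrite s1.
    by left; rewrite p1 inE l1 orbT Pl; split=> //; nia.
  right; have [a ca] : exists a, c = a + 2 by exists (c - 2); lia.
  have [b sb] : exists b, sumn l = b + 2 by exists (sumn l - 2); lia.
  rewrite Pl; split; first by rewrite ca sb; nia.
  by move: fl; rewrite ca sb; move: (spider_value l) (size l) => f q; nia.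
(* With three or more positive entries the weak bounds common to both alternatives suffice, since
   the new factor [2c+1] is at least 3. *)
move=> p1; right.
have {}pl : 2 <= positives l by move: pl p1; rewrite c0; lia.
have P1 : 6 * sumn l <= spider_prod l + 3 by case: (IH pl) => [[]|[]]; lia.
have q2 : 2 <= size l by apply: leq_trans pl (count_size _ _).
have s2 : 2 <= sumn l.
  move: pl; clear; rewrite /positives; elim: l => //= a l IH.
  have : count (fun c => 0 < c) l <= sumn l.
    by elim: l {IH} => //= b l; lia.
  by lia.
have f1 : 12 * sumn l * size l + 8 <= spider_value l + 10 * sumn l + 6 * size l.
  by case: (IH pl) => [[]|[]]; lia.
have [a ca] : exists a, c = a + 1 by exists (c - 1); lia.
have [b sb] : exists b, sumn l = b + 2 by exists (sumn l - 2); lia.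
have [q qb] : exists q, size l = q + 2 by exists (size l - 2); lia.
move: P1 f1; rewrite ca sb qb; move: (spider_prod l) (spider_value l) => P f P1 f1.
split; nia.
Qed.

(** * Spiders with two distinguished branches *)

Lemma card_set_sum (V : finType) (P : pred V) : #|[set x | P x]| = \sum_x (P x : nat).
Proof.
rewrite -sum1dep_card big_mkcond /=.
by apply: eq_bigr => x _; case: (P x).
Qed.

Lemma count_codom (V : finType) (T : eqType) (f : V -> T) k :
  count_mem k [seq f x | x <- enum V] = #|[set x | f x == k]|.
Proof.
rewrite count_map -size_filter cardE; congr size.
rewrite /enum_mem -enumT -filter_predI; apply: eq_filter => x.
by rewrite !inE andbT.
Qed.

(** Equal fibre sizes make the two lists of values rearrangements of each other, and the
    rearrangement of positions is [s]. *)
Lemma perm_of_fibers n (T : eqType) (f g : 'I_n -> T) :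
  (forall k, #|[set x | f x == k]| = #|[set x | g x == k]|) ->
  exists s : 'S_n, forall x, f x = g (s x).
Proof.
move=> fg; have : perm_eq [tuple f i | i < n] [tuple g i | i < n].
  by apply/allP => k _ /=; rewrite !count_codom fg.
case/tuple_permP => s E; exists s => x.
have /(congr1 (fun t => tnth t x)) :
    [tuple f i | i < n] = [tuple tnth [tuple g i | i < n] (s i) | i < n].
  exact: val_inj.
by rewrite !tnth_mktuple.
Qed.

Lemma spider_card (V : finType) (e : rel V) par w (l : seq V) : spider e par w -> uniq l ->
  (forall b, (b \in l) = (b != w) && (par b == w)) ->
  #|V| = (size l + sumn [seq kids par b | b <- l]).+1.
Proof.
move=> sp ul lE; have pw := spider_parw sp.
have -> : sumn [seq kids par b | b <- l] = #|[set x | par x \in l]|.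
  rewrite card_set_sum sumnE big_map (eq_bigr (fun b => \sum_x (par x == b : nat))); last first.
    by move=> b _; rewrite /kids card_set_sum.
  rewrite exchange_big; apply: eq_bigr => x _ /=.
  rewrite -count_uniq_mem // -sum1_count [in RHS]big_mkcond /=.
  by apply: eq_bigr => b _; rewrite eq_sym; case: eqP.
have <- := cardsC [set x | par x \in l].
suff -> : #|~: [set x | par x \in l]| = (size l).+1 by rewrite addnS addnC.
rewrite (cardsD1 w) !inE pw lE eqxx /= add1n -(card_uniqP ul); congr _.+1.
apply: eq_card => x; rewrite !inE !lE sp.1 eqxx andbT negbK.
by rewrite andbC.
Qed.

(* A spider with centre [w] all of whose leaves hang at [w], [b0] and [b1], the
   last two carrying [c0] and [c1] of them. *)
Definition twin (V : finType) (e : rel V) (c0 c1 : nat) : Prop :=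
  exists par w b0 b1,
  [/\ spider e par w, [/\ b0 != b1, b0 != w & b1 != w], par b0 = w /\ par b1 = w,
      forall x, par x \in [:: w; b0; b1] & kids par b0 = c0 /\ kids par b1 = c1].

Lemma twin_swap (V : finType) (e : rel V) (c0 c1 : nat) : twin e c0 c1 -> twin e c1 c0.
Proof.
case=> par [w [b0 [b1 [sp [b01 b0w b1w] [p0 p1] tw [k0 k1]]]]].
exists par, w, b1, b0; split=> //; first by rewrite eq_sym.
by move=> x; have := tw x; rewrite !inE [X in _ || X]orbC.
Qed.

(** The classes are the centre, the two distinguished branch vertices, the leaves at the centre, and
    the leaves at each of these branches. Adjacency depends only on the classes, and their sizes
    only on [#|V|] and the two leaf counts, so matching classes yields isomorphisms. *)
Definition twin_key (V : finType) (par : V -> V) (w b0 b1 x : V) : nat :=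
  if x == w then 0 else if x == b0 then 1 else if x == b1 then 2
  else if par x == w then 3 else if par x == b0 then 4 else 5.

Definition key_rel (i j : nat) : bool :=
  ((i, j) \in [:: (0, 1); (0, 2); (0, 3); (1, 4); (2, 5)]) ||
  ((j, i) \in [:: (0, 1); (0, 2); (0, 3); (1, 4); (2, 5)]).

Section TwinKey.
Variables (V : finType) (e : rel V) (par : V -> V) (w b0 b1 : V).
Hypotheses (sp : spider e par w) (b01 : b0 != b1) (b0w : b0 != w) (b1w : b1 != w).
Hypotheses (p0 : par b0 = w) (p1 : par b1 = w).
Hypothesis (tw : forall x, par x \in [:: w; b0; b1]).

Let key := twin_key par w b0 b1.

Lemma twin_key_rel x y : e x y = key_rel (key x) (key y).
Proof.
have pw := spider_parw sp.
move/eqP: b01 b0w b1w => b01' /eqP b0w' /eqP b1w'.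
have := tw x; have := tw y; rewrite sp.2 /key /twin_key !inE.
case: (x =P w) => xw; [|case: (x =P b0) => xb0; [|case: (x =P b1) => xb1]];
(case: (y =P w) => yw; [|case: (y =P b0) => yb0; [|case: (y =P b1) => yb1]]);
rewrite /=; do ?(case: eqP => ? //=); try congruence.
Qed.

Lemma twin_key_fiber k :
  #|[set x | key x == k]| =
    nth 0 [:: 1; 1; 1; #|V| - 3 - kids par b0 - kids par b1; kids par b0; kids par b1] k.
Proof.
have pw := spider_parw sp.
have F0 : #|[set x | key x == 0]| = 1.
  rewrite -[RHS](cards1 w); apply: eq_card => x; rewrite !inE /key /twin_key.
  by do ![case: ifP => //= _].
have F1 : #|[set x | key x == 1]| = 1.
  rewrite -[RHS](cards1 b0); apply: eq_card => x; rewrite !inE /key /twin_key.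
  have [->|_] := eqVneq x w; first by rewrite (eq_sym w b0) (negPf b0w).
  by do ![case: ifP => //= _].
have F2 : #|[set x | key x == 2]| = 1.
  rewrite -[RHS](cards1 b1); apply: eq_card => x; rewrite !inE /key /twin_key.
  have [->|_] := eqVneq x w; first by rewrite (eq_sym w b1) (negPf b1w).
  have [->|_] := eqVneq x b0; first by rewrite (negPf b01).
  by do ![case: ifP => //= _].
have F4 : #|[set x | key x == 4]| = kids par b0.
  apply: eq_card => x; rewrite !inE /key /twin_key.
  have [->|_] := eqVneq x w; first by rewrite pw (eq_sym w b0) (negPf b0w).
  have [->|_] := eqVneq x b0; first by rewrite p0 (eq_sym w b0) (negPf b0w).
  have [->|_] := eqVneq x b1; first by rewrite p1 (eq_sym w b0) (negPf b0w).
  have [->|_] := eqVneq (par x) w; first by rewrite (eq_sym w b0) (negPf b0w).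
  by case: ifP.
have F5 : #|[set x | key x == 5]| = kids par b1.
  apply: eq_card => x; rewrite !inE /key /twin_key.
  have [->|_] := eqVneq x w; first by rewrite pw (eq_sym w b1) (negPf b1w).
  have [->|_] := eqVneq x b0; first by rewrite p0 (eq_sym w b1) (negPf b1w).
  have [->|_] := eqVneq x b1; first by rewrite p1 (eq_sym w b1) (negPf b1w).
  have := tw x; rewrite !inE.
  have [->|_] := eqVneq (par x) w; first by rewrite (eq_sym w b1) (negPf b1w).
  have [->|_] /= := eqVneq (par x) b0; first by rewrite (negPf b01).
  by move=> ->.
have total : #|V| = \sum_(j <- iota 0 6) #|[set x | key x == j]|.
  under eq_bigr do rewrite card_set_sum.
  rewrite exchange_big -sum1_card /=; apply: eq_bigr => x _.
  rewrite /key /twin_key !big_cons big_nil.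
  by do ![case: ifP => //= _].
rewrite !big_cons big_nil F0 F1 F2 F4 F5 in total.
have F3 : #|[set x | key x == 3]| = #|V| - 3 - kids par b0 - kids par b1 by lia.
case: k => [|[|[|[|[|[|k]]]]]] //.
rewrite [RHS]/= nth_nil; apply: eq_card0 => x; rewrite !inE /key /twin_key.
by do ![case: ifP => //= _].
Qed.

End TwinKey.

Lemma twin_iso n (e1 e2 : rel 'I_n) c0 c1 : twin e1 c0 c1 -> twin e2 c0 c1 -> graph_iso n e1 e2.
Proof.
case=> par [w [b0 [b1 [sp [b01 b0w b1w] [p0 p1] tw [k0 k1]]]]].
case=> par' [w' [b0' [b1' [sp' [b01' b0w' b1w'] [p0' p1'] tw' [k0' k1']]]]].
have [|s sE] := @perm_of_fibers n _ (twin_key par w b0 b1) (twin_key par' w' b0' b1').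
  move=> k; rewrite (twin_key_fiber sp) // (twin_key_fiber sp') //.
  by rewrite k0 k1 k0' k1'.
by exists s => x y; rewrite (twin_key_rel sp b01 b0w) // (twin_key_rel sp' b01' b0w') // !sE.
Qed.

Lemma twin_per (V : finType) (e : rel V) c0 c1 : twin e c0 c1 ->
  exists q, [/\ q + c0 + c1 + 1 = #|V|, 2 <= q &
    wper (nbrs e setT) e setT = (2 * q - 2) * ((2 * c0 + 1) * (2 * c1 + 1)) + 2 * c0 + 2 * c1 + 2].
Proof.
case=> par [w [b0 [b1 [sp [b01 b0w b1w] [p0 p1] tw [k0 k1]]]]].
pose B := [set b | (b != w) && (par b == w)].
pose l := b0 :: b1 :: enum (B :\ b0 :\ b1).
have ul : uniq l.
  by rewrite /l /= inE negb_or b01 !mem_enum !inE !eqxx /= andbF enum_uniq.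
have lE b : (b \in l) = (b != w) && (par b == w).
  rewrite !inE mem_enum !inE.
  have [->|_] := eqVneq b b0; first by rewrite b0w p0 eqxx.
  have [->|_] := eqVneq b b1; first by rewrite b1w p1 eqxx.
  by [].
set r := enum _ in l ul lE.
have kr : [seq kids par b | b <- r] = nseq (size r) 0.
  rewrite -(size_map (kids par) r); apply/all_pred1P; rewrite all_map; apply/allP => b.
  rewrite mem_enum !inE => /and4P[bb1 bb0 bw /eqP pb] /=.
  rewrite /kids; apply/eqP/eq_card0 => x; rewrite !inE.
  have := tw x; rewrite !inE => /or3P[] /eqP->; by rewrite eq_sym; apply: negPf.
have pr : spider_prod (nseq (size r) 0) = 1 /\ spider_sum (nseq (size r) 0) = size r.
  by elim: (size r) => //= m [-> ->]; lia.
exists (size l); rewrite (spider_card sp ul lE) (spider_per sp ul lE) /= kr k0 k1 sumn_nseq.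
rewrite pr.1 pr.2; split; nia.
Qed.

(** * Laplacians and the named trees *)

Section Laplacian.
Variables (n : nat) (e : rel 'I_n).

Lemma deg_nbrs x : deg n e x = nbrs e setT x.
Proof. by rewrite nbrs_card; apply: eq_card => y; rewrite !inE. Qed.

Lemma arcs_card : arcs e setT = #|[set u : 'I_n * 'I_n | e u.1 u.2]|.
Proof.
rewrite card_set_sum -(pair_bigA _ (fun x y => e x y : nat)) /arcs /nbrs /=.
by apply: eq_big => [x|x _]; [rewrite inE|apply: eq_bigl => y; rewrite inE].
Qed.

(* Conjugating by the signs of a 2-colouring turns the off-diagonal [-1]s into [1]s. *)
Lemma per_laplacian (c : 'I_n -> bool) : irreflexive e ->
  (forall x y, e x y -> c x != c y) ->
  per _ n (laplacian n e) = Posz (wper (nbrs e setT) e setT).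
Proof.
move=> eirr proper; rewrite -natz /wper natr_sum /per.
apply: eq_big => [s|s _]; first by apply/esym/subsetP.
rewrite natr_prod; pose eps (x : 'I_n) : int := ((-1) ^+ c x)%R.
have eps2 x : (eps x * eps x = 1)%R by rewrite /eps; case: (c x).
have LE i : laplacian n e i (s i) = ((eps i * eps (s i)) * (wterm (nbrs e setT) e s i)%:R)%R.
  rewrite mxE /wterm (eq_sym i) natz; have [->|_] := eqVneq (s i) i.
    by rewrite eps2 mul1r deg_nbrs.
  have [/proper|_] := boolP (e i (s i)); last by rewrite mulr0.
  by rewrite /eps; case: (c i); case: (c (s i)).
rewrite (eq_bigr _ (fun i _ => LE i)) big_split /= big_split /=.
have -> : (\prod_i eps (s i) = \prod_i eps i)%R by rewrite [RHS](reindex_inj (@perm_inj _ s)).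
rewrite -big_split /= big1 ?mul1r //.
by apply: eq_bigl => i; rewrite inE.
Qed.

Lemma per_spider par w : spider e par w ->
  per _ n (laplacian n e) = Posz (wper (nbrs e setT) e setT).
Proof.
move=> sp; have pw := spider_parw sp.
apply: (@per_laplacian (fun x => (x != w) && (par x == w))).
  by move=> x; rewrite sp.2 eqxx.
move=> x y; rewrite sp.2 => /andP[xy].
wlog pxy : x y xy / par x = y.
  move=> W /orP[/eqP pxy|/eqP pyx]; first by apply: W => //; rewrite pxy eqxx.
  by rewrite eq_sym; apply: W; rewrite // 1?eq_sym // pyx eqxx.
move=> _; subst y; rewrite sp.1 eqxx andbT.
have [xw|xw] /= := eqVneq x w; first by rewrite xw pw eqxx in xy.
by case: (par x == w).
Qed.

Lemma twin_per_laplacian c0 c1 q : twin e c0 c1 -> q + c0 + c1 + 1 = n ->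
  per _ n (laplacian n e) =
  Posz ((2 * q - 2) * ((2 * c0 + 1) * (2 * c1 + 1)) + 2 * c0 + 2 * c1 + 2).
Proof.
move=> tw qn; have [q' [qn' _ val]] := twin_per tw.
case: tw => par [w [_ [_ [sp _ _ _ _]]]]; rewrite (per_spider sp) val.
rewrite card_ord in qn'; have -> // : q' = q by lia.
Qed.

End Laplacian.

Lemma per_iso n (e1 e2 : rel 'I_n) : graph_iso n e1 e2 ->
  per _ n (laplacian n e1) = per _ n (laplacian n e2).
Proof.
case=> s sE; rewrite /per [RHS](reindex_inj (conjg_inj s)); apply: eq_bigr => t _.
rewrite [RHS](reindex_inj (@perm_inj _ s)); apply: eq_bigr => i _.
rewrite permJ !mxE (inj_eq perm_inj) -sE.
case: eqP => // _; congr Posz; rewrite /deg -(card_imset _ (@perm_inj _ s)).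
apply: eq_card => y; rewrite inE; apply/imsetP/idP => [[z]|eiy].
  by rewrite inE sE => ? ->.
by exists (s^-1 y)%g; rewrite ?inE ?sE permKV.
Qed.

Lemma card_interval n lo hi : hi <= n -> #|[set x : 'I_n | lo <= x < hi]| = hi - lo.
Proof.
move=> hn; rewrite card_set_sum.
suff -> : \sum_(x < n) (lo <= x < hi : nat) = minn n hi - lo by rewrite (minn_idPr hn).
elim: n {hn} => [|n IH]; first by rewrite big_ord0 min0n.
rewrite big_ord_recr /= IH; case: (leqP lo n) => ?; case: (ltnP n hi) => ?; rewrite /=; lia.
Qed.

(** The rooting [f] may differ from the parent function defining [e]; only the adjacency has to
    agree. This permits re-rooting at the centre of the spider. *)
Lemma twin_of_par n (e : rel 'I_n) (f : nat -> nat) (w b0 b1 lo0 hi0 lo1 hi1 : nat) :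
  [/\ w < n, b0 < n & b1 < n] -> [/\ b0 != b1, b0 != w & b1 != w] ->
  [/\ f w = w, f b0 = w & f b1 = w] ->
  (forall i, i < n -> [|| f i == w, f i == b0 | f i == b1]) ->
  hi0 <= n -> hi1 <= n ->
  (forall i, i < n -> (f i == b0) = (lo0 <= i < hi0)) ->
  (forall i, i < n -> (f i == b1) = (lo1 <= i < hi1)) ->
  (forall x y : 'I_n, e x y = (x != y :> nat) && ((f x == y) || (f y == x))) ->
  twin e (hi0 - lo0) (hi1 - lo1).
Proof.
move=> [wn b0n b1n] [b01 b0w b1w] [fw fb0 fb1] fE h0 h1 k0 k1 eE.
have fn i : i < n -> f i < n by move/fE/or3P => [] /eqP->.
pose par (x : 'I_n) : 'I_n := Ordinal (fn x (ltn_ord x)).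
exists par, (Ordinal wn), (Ordinal b0n), (Ordinal b1n); split=> //.
- split=> [x|x y]; last by rewrite eE.
  by apply: val_inj => /=; case/or3P: (fE x (ltn_ord x)) => /eqP->.
- by split; apply: val_inj.
- by move=> x; rewrite !inE; apply: fE.
rewrite /kids -(card_interval lo0 h0) -(card_interval lo1 h1).
by split; apply: eq_card => x; rewrite !inE -val_eqE /= ?k0 ?k1.
Qed.

(** The centre is label 0, and a pendant vertex there serves as second distinguished branch, with no
    leaves. *)
Lemma Dtree_twin p q : 1 < p -> 0 < q -> twin (Dtree p q) (q - 1) 0.
Proof.
move=> hp hq; have := @twin_of_par (p + q) (Dtree p q) (par_D p q) 0 1 2 p.+1 (p + q) 0 0.
rewrite subnn (_ : p + q - p.+1 = q - 1); last by lia.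
apply; rewrite /par_D.
- by split; lia.
- by [].
- by split=> //; case: ifP => //; lia.
- by move=> i hi; case: ifP.
- by [].
- by lia.
- by move=> i hi; case: ifP => ?; lia.
- by move=> i hi; case: ifP => ?; lia.
- by [].
Qed.

(** The same double star seen from its other centre: sending the labels 0 and 1 to 1 moves the
    root. *)
Lemma Dtree_twin' p q : 0 < p -> 1 < q -> twin (Dtree p q) (p - 1) 0.
Proof.
move=> hp hq.
have := @twin_of_par (p + q) (Dtree p q) (fun i => if i <= 1 then 1 else par_D p q i)
  1 0 p.+1 2 p.+1 0 0.
rewrite subnn (_ : p.+1 - 2 = p - 1); last by lia.
apply; rewrite /par_D.
- by split; lia.
- by split; lia.
- by split=> //; do 2?case: ifP => ?; lia.
- by move=> i hi; do 2?case: ifP => ?; lia.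
- by lia.
- by lia.
- by move=> i hi; do 2?case: ifP => ?; lia.
- by move=> i hi; do 2?case: ifP => ?; lia.
- move=> x y; rewrite /Dtree /tree_of_par /par_D -!val_eqE /=.
  by apply/idP/idP; do 4?case: ifP => ?; lia.
Qed.

Lemma D'tree_twin p q : 2 < p -> 2 < q -> twin (D'tree p q) 1 (p - 2).
Proof.
move=> hp hq.
have := @twin_of_par (p + q) (D'tree p q) (fun i => if i <= 1 then 1 else par_D' p q i)
  1 (p + q - 2) 0 (p + q - 1) (p + q) 2 p.
rewrite (_ : p + q - (p + q - 1) = 1); last by lia.
apply; rewrite /par_D'.
- by split; lia.
- by split; lia.
- by split=> //; do 3?case: ifP => ?; lia.
- by move=> i hi; do 3?case: ifP => ?; lia.
- by lia.
- by lia.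
- by move=> i hi; do 3?case: ifP => ?; lia.
- by move=> i hi; do 3?case: ifP => ?; lia.
- move=> x y; rewrite /D'tree /tree_of_par /par_D' -!val_eqE /=.
  have := ltn_ord x; have := ltn_ord y; move: (val x) (val y) => i j.
  by move=> hi hj; apply/idP/idP; do 6?case: ifP => ?; lia.
Qed.

Lemma D''tree_twin p q : 2 < p -> 2 < q -> twin (D''tree p q) 1 (q - 2).
Proof.
move=> hp hq.
have := @twin_of_par (p + q) (D''tree p q) (par_D'' p q)
  0 (p + q - 2) 1 (p + q - 1) (p + q) p (p + q - 2).
rewrite (_ : p + q - (p + q - 1) = 1); last by lia.
rewrite (_ : p + q - 2 - p = q - 2); last by lia.
apply; rewrite /par_D''.
- by split; lia.
- by split; lia.
- by split=> //; do 3?case: ifP => ?; lia.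
- by move=> i hi; do 3?case: ifP => ?; lia.
- by lia.
- by lia.
- by move=> i hi; do 3?case: ifP => ?; lia.
- by move=> i hi; do 3?case: ifP => ?; lia.
- by [].
Qed.

Lemma Ttree_twin n a : 3 + a <= n -> twin (Ttree n 3 a) a (n - 3 - a).
Proof.
move=> ha; rewrite -[X in twin _ X _](addKn 3) -subnDA.
apply: (@twin_of_par n _ (fun i => if i <= 1 then 1 else par_T 3 a i) 1 0 2 3 _ _ n); rewrite /par_T.
- by split; lia.
- by [].
- by split.
- by move=> i hi; do 3?case: ifP => ? //; lia.
- by [].
- by [].
- by move=> i hi; do 3?case: ifP => ? //; lia.
- by move=> i hi; do 3?case: ifP => ? //; lia.
- move=> x y; rewrite /Ttree /tree_of_par /par_T -!val_eqE /=.
  by apply/idP/idP; do 6?case: ifP => ?; lia.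
Qed.

(** * Classification of bipartite trees *)

Lemma positives_rem (T : finType) (k : T -> nat) (l : seq T) b : b \in l ->
  positives [seq k x | x <- l] = (0 < k b) + positives [seq k x | x <- rem b l] /\
  sumn [seq k x | x <- l] = k b + sumn [seq k x | x <- rem b l].
Proof.
move=> bl; have pl := perm_map k (perm_to_rem bl).
by rewrite /positives (seq.permP pl) (perm_sumn pl).
Qed.

Lemma positives0 (T : finType) (k : T -> nat) (l : seq T) :
  positives [seq k x | x <- l] = 0 -> sumn [seq k x | x <- l] = 0 /\ {in l, forall b, k b = 0}.
Proof.
move=> pl; split; first by have [] := spider_flat pl.
move=> b bl; move/eqP: pl; rewrite /positives -leqn0 leqNgt -has_count => /hasPn /(_ (k b)).
by rewrite map_f // => /(_ isT); case: (k b).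
Qed.

Lemma twin_intro (V : finType) (e : rel V) par w (l : seq V) b0 b1 : spider e par w ->
  (forall b, (b \in l) = (b != w) && (par b == w)) -> b0 \in l -> b1 \in l -> b0 != b1 ->
  (forall b, b \in l -> b != b0 -> b != b1 -> kids par b = 0) ->
  twin e (kids par b0) (kids par b1).
Proof.
move=> sp lE b0l b1l b01 none.
move: (b0l) (b1l); rewrite !lE => /andP[b0w /eqP p0] /andP[b1w /eqP p1].
exists par, w, b0, b1; split=> // x; rewrite !inE.
have [//|xw] := eqVneq (par x) w; have [//|x0] := eqVneq (par x) b0.
have [//|x1] := eqVneq (par x) b1.
have := none (par x); rewrite lE xw sp.1 eqxx => /(_ isT x0 x1) /eqP.
by rewrite cards_eq0 => /eqP/setP/(_ x); rewrite !inE eqxx.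
Qed.

Section ColoredSpider.
Context {V : finType} (e : rel V) (par : V -> V) (w : V) (c : V -> bool).
Hypothesis sp : spider e par w.
Hypothesis proper : forall x y, e x y -> c x != c y.

Let l := enum [set x | c x != c w].

Lemma colored_branches b : (b \in l) = (b != w) && (par b == w).
Proof.
have pw := spider_parw sp.
have hub x : x != w -> par x == w -> c x != c w.
  by move=> xw xp; rewrite eq_sym; apply: proper; rewrite (spider_hub_adj sp) xw.
rewrite mem_enum inE; apply/idP/andP => [cb|[]]; last exact: hub.
have bw : b != w by apply: contra cb => /eqP->.
split=> //; apply: contraT => pb.
have := hub _ pb; rewrite sp.1 eqxx => /(_ isT) cpb.
have : e b (par b) by rewrite (spider_leaf_adj sp) // eqxx.
by move/proper; move: cb cpb; case: (c b); case: (c w); case: (c (par b)).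
Qed.

(** With the centre in the class of size [p], the [q] branches share [p-1] leaves. A single branch
    with leaves gives a double star; otherwise [spider_value_ge] applies, and its exact case leaves
    just one further branch, with [p-2] leaves. The last alternative is an excess of at least
    [8(q-1)] over [(2p-3)(6q-5)+3]. *)
Lemma colored_spider p q : #|[set x | c x == c w]| = p -> #|[set x | c x != c w]| = q ->
  1 < p -> 1 < q -> let f := wper (nbrs e setT) e setT in
  [\/ twin e (p - 1) 0, twin e 1 (p - 2) |
      12 * p * q + 10 + 8 * q <= f + 10 * p + 18 * q].
Proof.
move=> cp cq p1 q1 f; have ul : uniq l := enum_uniq _.
have lE := colored_branches; have sl : size l = q by rewrite -cardE.
have cV : #|V| = p + q.
  rewrite -cp -cq -(cardsC [set x | c x == c w]); congr (_ + _).
  by apply: eq_card => x; rewrite !inE.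
have sum : sumn [seq kids par b | b <- l] = p - 1 by have := spider_card sp ul lE; lia.
have fE : f = spider_value [seq kids par b | b <- l].
  by rewrite /f (spider_per sp ul lE) /spider_value size_map.
have other b : b \in l -> exists b', [/\ b' \in l, b' != b & b' \in rem b l].
  move=> bl; have : 0 < size (rem b l) by rewrite size_rem // sl; lia.
  case E : (rem b l) => [//|b' r] _; exists b'.
  have b'r : b' \in rem b l by rewrite E mem_head.
  by move: (b'r); rewrite mem_rem_uniq // !inE => /andP[-> ->]; rewrite eqxx.
have [p0|pos] := posnP (positives [seq kids par b | b <- l]).
  by have [s0 _] := positives0 p0; move: s0; rewrite sum; lia.
have [p2|p2] := ltnP 1 (positives [seq kids par b | b <- l]); last first.
  have pos1 : positives [seq kids par b | b <- l] = 1 by lia.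
  move: pos; rewrite /positives -has_count => /hasP[_ /mapP[b0 b0l ->] k0].
  have [pr sr] := positives_rem (kids par) b0l.
  have [|s0 z] := @positives0 _ (kids par) (rem b0 l); first by lia.
  have [b1 [b1l b10 b1r]] := other b0 b0l.
  constructor 1; have -> : p - 1 = kids par b0 by lia.
  rewrite -(z b1 b1r); apply: (twin_intro sp lE) => //; first by rewrite eq_sym.
  by move=> b bl bb0 _; apply: z; rewrite mem_rem_uniq // inE bb0.
have [[pos2 /mapP[b0 b0l k0] _ _]|[_]] := spider_value_ge p2.
  have [pr sr] := positives_rem (kids par) b0l; rewrite -k0 in pr sr.
  have : 0 < positives [seq kids par b | b <- rem b0 l] by lia.
  rewrite {1}/positives -has_count => /hasP[_ /mapP[b1 b1r ->] k1].
  have [pr' sr'] := positives_rem (kids par) b1r.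
  have [|s0 z] := @positives0 _ (kids par) (rem b1 (rem b0 l)); first by lia.
  constructor 2; have -> : p - 2 = kids par b1 by lia.
  rewrite k0; move: (b1r); rewrite mem_rem_uniq // inE => /andP[b10 b1l].
  apply: (twin_intro sp lE) => //; first by rewrite eq_sym.
  by move=> b bl bb0 bb1; apply: z; rewrite mem_rem_uniq ?rem_uniq // inE bb1 mem_rem_uniq // inE bb0.
rewrite -fE size_map sl sum => le; constructor 3.
have [r pE] : exists r, p = r + 1 by exists (p - 1); lia.
by move: le; rewrite pE addnK; lia.
Qed.

End ColoredSpider.

Lemma tree_facts n (e : rel 'I_n) : 0 < n -> is_tree n e ->
  [/\ symmetric e, irreflexive e, forall x y, connect e x y & arcs e setT <= 2 * #|'I_n| - 1].
Proof.
move=> n0 [[es ei] [ec en]]; split=> //.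
by move: en; rewrite /n_edges -arcs_card card_ord; lia.
Qed.

(** The three groups arise according to whether the class of size [p], the class of size [q], or
    neither has at most one non-leaf. *)
Lemma bipartite_tree_cases n (e : rel 'I_n) p q : in_Tpq n p q e -> 2 < p -> 2 < q ->
  exists f, per _ n (laplacian n e) = Posz f /\
  ([\/ twin e (p - 1) 0, twin e 1 (p - 2) | 12 * p * q + 10 + 8 * q <= f + 10 * p + 18 * q] \/
   [\/ twin e (q - 1) 0, twin e 1 (q - 2) | 12 * q * p + 10 + 8 * p <= f + 10 * q + 18 * p] \/
   12 * p * q + 19 <= f + 10 * p + 18 * q /\ 12 * q * p + 19 <= f + 10 * q + 18 * p).
Proof.
move=> [te [A [cA [cB eA]]]] p2 q2.
have n0 : 0 < n by have := max_card A; rewrite card_ord cA; lia.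
have [es ei ec few] := tree_facts n0 te.
pose c x := x \in A.
have proper x y : e x y -> c x != c y by apply: eA.
exists (wper (nbrs e setT) e setT); split; first exact: (per_laplacian ei proper).
have cE b : #|[set x | c x == b]| = if b then p else q.
  by case: b; [rewrite -cA|rewrite -cB]; apply: eq_card => x; rewrite !inE /c ?eqb_id ?eqbF_neg.
pose central b := [exists w, (c w == b) &&
  [forall x, (c x == b) && (x != w) ==> (nbrs e setT x == 1)]].
have inner b : ~~ central b -> forall w, c w = b ->
    exists x, [/\ c x = b, x != w & 2 <= nbrs e setT x].
  rewrite negb_exists => /forallP none w cw; have := none w.
  rewrite cw eqxx negb_forall => /existsP[x]; rewrite negb_imply => /andP[/andP[/eqP cx xw]].
  by have := nbrs_gt0_connected es ec xw => ? ?; exists x; split=> //; lia.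
have central_spider b : central b -> let f := wper (nbrs e setT) e setT in
    let p' := if b then p else q in let q' := if b then q else p in
    [\/ twin e (p' - 1) 0, twin e 1 (p' - 2) |
      12 * p' * q' + 10 + 8 * q' <= f + 10 * p' + 18 * q'].
  case/existsP => w /andP[/eqP cw /forallP leaf].
  have [par sp] : exists par, spider e par w.
    apply: (spider_tree es ei ec proper) => x cx xw.
    by have := leaf x; rewrite cx cw eqxx xw => /eqP.
  apply: (colored_spider sp proper); rewrite ?cw ?cE //; try by case: ifP; lia.
  have -> : [set x | c x != b] = [set x | c x == ~~ b].
    by apply/setP => x; rewrite !inE; case: (c x); case: b {cw leaf}.
  by rewrite cE; case: b {cw leaf}.
have [/central_spider ct|ct] := boolP (central true); first by left.
have [/central_spider cf|cf] := boolP (central false); first by right; left.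
right; right; have [x xA] : exists x, x \in A by apply/card_gt0P; lia.
have [y yA] : exists y, y \in ~: A by apply/card_gt0P; lia.
have long : long e c setT.
  apply: (long_tree es ei ec proper few) => [[]|]; [exact: inner|exact: inner|].
  by exists x, y; rewrite /c xA; move: yA; rewrite inE => /negPf->.
have colE b : colored c setT b = if b then p else q.
  by rewrite -cE card_set_sum /colored; apply: eq_bigl => z; rewrite inE.
by have := long_per long true; have := long_per long false; rewrite !colE.
Qed.


(** A non-leaf outside the class [{x, y}] is adjacent to both [x] and [y], and two such vertices
    would form a square. So the tree is a spider around the common neighbour, with branches [x] and
    [y]. *)
Lemma two_center_tree n (e : rel 'I_n) : 3 < n -> in_Tpq n 2 (n - 2) e ->
  exists a, [/\ a <= (n - 3)./2 & twin e a (n - 3 - a)].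
Proof.
move=> n4 [te [A [cA [cB eA]]]].
have [|es ei ec few] := tree_facts _ te; first by lia.
pose c x := x \in A.
have proper x y : e x y -> c x != c y by apply: eA.
have /cards2P[x [y [xy AE]]] : #|A| == 2 by rewrite cA.
have inA z : c z = (z == x) || (z == y) by rewrite /c AE !inE.
have both b : b \notin A -> 2 <= nbrs e setT b -> e b x && e b y.
  move=> bA nb; have adj z t : z \in A -> t \in A -> z != t -> A = [set z; t] -> e b z.
    move=> zA tA zt Azt; have [s [_ st bs]] := nbrs_ge2 t nb.
    have : s \in A by move/proper: bs; rewrite /c (negPf bA); case: (s \in A).
    by rewrite Azt !inE (negPf st) orbF => /eqP <-.
  have xA : x \in A by rewrite AE !inE eqxx.
  have yA : y \in A by rewrite AE !inE eqxx orbT.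
  by rewrite (adj x y) // (adj y x) // 1?eq_sym // AE setUC.
have [w wA leaf] : exists2 w, w \notin A & forall b, b \notin A -> b != w -> nbrs e setT b = 1.
  have [b0 b0A] : exists b, b \in ~: A by apply/card_gt0P; lia.
  have pos b : b \notin A -> 0 < nbrs e setT b.
    move=> bA; apply: (nbrs_gt0_connected es ec (z := x)).
    by apply: contraNneq bA => ->; rewrite AE !inE eqxx.
  have [/existsP[w /andP[wA nw]]|] := boolP [exists w, (w \notin A) && (2 <= nbrs e setT w)].
    exists w => // b bA bw; apply/eqP; rewrite eqn_leq pos // andbT leqNgt.
    apply/negP => nb; have /andP[wx wy] := both w wA nw; have /andP[bx by'] := both b bA nb.
    have := @no_square _ e es ei ec few x w y b; rewrite es wx wy es by' xy eq_sym bw.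
    by rewrite bx => /(_ isT isT isT isT isT).
  (* If all vertices outside [A] are leaves, any [b0] meets the requirement. *)
  rewrite negb_exists => /forallP none; exists b0; first by rewrite inE in b0A.
  by move=> b bA _; have := none b; rewrite bA /= => ?; have := pos b bA; lia.
have cw : c w = false by apply: negPf.
have [par sp] : exists par, spider e par w.
  by apply: (spider_tree es ei ec proper) => b; rewrite cw => cb; apply: leaf; rewrite -/(c b) cb.
have lE b : (b \in [:: x; y]) = (b != w) && (par b == w).
  rewrite -(colored_branches sp proper) mem_enum !inE cw eqbF_neg negbK.
  by rewrite inA.
have := spider_card (l := [:: x; y]) sp _ lE; rewrite /= inE xy card_ord => /(_ isT) nE.
have [c0 [c1 [tw cE]]] : exists c0 c1, twin e c0 c1 /\ n = c0 + c1 + 3.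
  exists (kids par x), (kids par y); split; last by rewrite [LHS]nE addn0 addn3.
  apply: (twin_intro sp lE); rewrite ?inE ?eqxx ?orbT //.
  by move=> b; rewrite !inE => /orP[->|->].
have [c01|c10] := leqP c0 c1.
  exists c0; split; first by lia.
  by have -> : n - 3 - c0 = c1 by lia.
exists c1; split; first by lia.
have -> : n - 3 - c1 = c0 by lia.
exact: twin_swap.
Qed.

(** * Values of the named trees and the final comparison *)

Lemma iso_trans n (e1 e2 e3 : rel 'I_n) :
  graph_iso n e1 e2 -> graph_iso n e2 e3 -> graph_iso n e1 e3.
Proof. by move=> [s sE] [t tE]; exists (s * t)%g => x y; rewrite sE tE !permM. Qed.

Lemma Ttree_per n a : 3 + a <= n -> per _ n (laplacian n (Ttree n 3 a)) =
  Posz (2 * ((2 * a + 1) * (2 * (n - 3 - a) + 1)) + 2 * (n - 3) + 2).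
Proof.
move=> an; rewrite (twin_per_laplacian (q := 2) (Ttree_twin an)); last by lia.
by congr Posz; lia.
Qed.

(** The factors [2a+1] and [2(n-3-a)+1] have a fixed sum, so their product grows as they approach
    each other, which they do up to [(n - 3)./2]. *)
Lemma Ttree_per_lt n a b : a < b -> b <= (n - 3)./2 -> 3 <= n ->
  (per _ n (laplacian n (Ttree n 3 a)) < per _ n (laplacian n (Ttree n 3 b)))%R.
Proof.
move=> ab bn n3; rewrite !Ttree_per ?ltz_nat; [|lia|lia].
have [m nE] : exists m, n = m + 2 * b + 3 by exists (n - 2 * b - 3); lia.
have [k bE] : exists k, b = a + k + 1 by exists (b - a - 1); lia.
have -> : n - 3 - a = m + 2 * b - a by lia.
have -> : n - 3 - b = m + b by lia.
have -> : m + 2 * b - a = m + b + k + 1 by lia.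
rewrite bE; nia.
Qed.

(** The value is [(2p-3)(6q-5)+3], expanded and rearranged to avoid truncated subtraction. *)
Lemma D'tree_per p q : 2 < p -> 2 < q -> exists f,
  per _ (p + q) (laplacian (p + q) (D'tree p q)) = Posz f /\ f + 10 * p + 18 * q = 12 * p * q + 18.
Proof.
move=> hp hq; eexists; split.
  by apply: (twin_per_laplacian (q := q) (D'tree_twin hp hq)); lia.
have [r ->] : exists r, p = r + 2 by exists (p - 2); lia.
have [t ->] : exists t, q = t + 1 by exists (q - 1); lia.
rewrite addnK; have -> : 2 * (t + 1) - 2 = 2 * t by lia.
by nia.
Qed.

Lemma D''tree_per p q : 2 < p -> 2 < q -> exists f,
  per _ (p + q) (laplacian (p + q) (D''tree p q)) = Posz f /\ f + 10 * q + 18 * p = 12 * p * q + 18.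
Proof.
move=> hp hq; eexists; split.
  by apply: (twin_per_laplacian (q := p) (D''tree_twin hp hq)); lia.
have [r ->] : exists r, q = r + 2 by exists (q - 2); lia.
have [t ->] : exists t, p = t + 1 by exists (p - 1); lia.
rewrite addnK; have -> : 2 * (t + 1) - 2 = 2 * t by lia.
by nia.
Qed.

(** The second bound exceeds the first by [8(q-p)], so one strict inequality against the second
    serves both claims. An excess of [8(q-1)] over the first is enough for it, as [p > 1]. *)
Lemma tree_cases p q (T : rel 'I_(p + q)) : 2 < p -> p <= q -> in_Tpq (p + q) p q T ->
  [\/ graph_iso (p + q) T (Dtree p q), graph_iso (p + q) T (D'tree p q),
      graph_iso (p + q) T (D''tree p q) |
      exists f, per _ (p + q) (laplacian (p + q) T) = Posz f /\
        12 * p * q + 18 < f + 10 * q + 18 * p].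
Proof.
move=> hp hpq hT; have hq : 2 < q by lia.
have [f [fE [[tw|tw|le]|[[tw|tw|le]|[le1 le2]]]]] := bipartite_tree_cases hT hp hq.
- by constructor 1; apply: (twin_iso tw); apply: Dtree_twin'; lia.
- by constructor 2; apply: (twin_iso tw); apply: D'tree_twin.
- by constructor 4; exists f; split=> //; lia.
- by constructor 1; apply: (twin_iso tw); apply: Dtree_twin; lia.
- by constructor 3; apply: (twin_iso tw); apply: D''tree_twin.
- by constructor 4; exists f; split=> //; lia.
- by constructor 4; exists f; split=> //; lia.
Qed.

Theorem theorem3p3 (p q : nat) (hp : (1 <= p)%N) (hpq : (p <= q)%N) :
  (* (i) *)
  (p = 2%N ->
     (forall T : rel 'I_(p + q), in_Tpq (p + q) 2 (p + q - 2) T ->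
        exists i : nat, [/\ (i <= (p + q - 3)./2)%N,
          graph_iso (p + q) T (Ttree (p + q) 3 i) &
          forall j : nat, (j <= (p + q - 3)./2)%N ->
            graph_iso (p + q) T (Ttree (p + q) 3 j) -> j = i])
     /\ per _ (p + q) (laplacian (p + q) (Dtree p q)) = per _ (p + q) (laplacian (p + q) (Ttree (p + q) 3 0))
     /\ (forall i : nat, (i < (p + q - 3)./2)%N ->
           (per _ (p + q) (laplacian (p + q) (Ttree (p + q) 3 i))
             < per _ (p + q) (laplacian (p + q) (Ttree (p + q) 3 i.+1)))%R)) /\
  (* (ii) *)
  ((2 < p)%N ->
     (forall T : rel 'I_(p + q), in_Tpq (p + q) p q T ->
        ~ graph_iso (p + q) T (Dtree p q) ->
        (((2 * p%:Z - 3) * (6 * q%:Z - 5) + 3)%R <= per _ (p + q) (laplacian (p + q) T))%R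
        /\ (per _ (p + q) (laplacian (p + q) T) = ((2 * p%:Z - 3) * (6 * q%:Z - 5) + 3)%R
            <-> graph_iso (p + q) T (D'tree p q)))
     /\
     ((p < q)%N ->
      forall T : rel 'I_(p + q), in_Tpq (p + q) p q T ->
        ~ graph_iso (p + q) T (Dtree p q) -> ~ graph_iso (p + q) T (D'tree p q) ->
        (((2 * q%:Z - 3) * (6 * p%:Z - 5) + 3)%R <= per _ (p + q) (laplacian (p + q) T))%R
        /\ (per _ (p + q) (laplacian (p + q) T) = ((2 * q%:Z - 3) * (6 * p%:Z - 5) + 3)%R
            <-> graph_iso (p + q) T (D''tree p q)))).

Proof.
split=> [p2|p2].
  subst p; split; [move=> T hT|split].
  - have n4 : 3 < 2 + q by lia.
    have [i [hi tw]] := two_center_tree n4 hT.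
    have iT j : j <= (2 + q - 3)./2 -> 3 + j <= 2 + q by lia.
    exists i; split=> //; first exact: twin_iso tw (Ttree_twin (iT _ hi)).
    (* Uniqueness of the index comes from the permanent: isomorphic trees share its value, while it
       is strictly increasing along the family. *)
    move=> j hj /per_iso; rewrite (per_iso (twin_iso tw (Ttree_twin (iT _ hi)))) => E.
    have [ij|ji|//] := ltngtP i j.
      by have := Ttree_per_lt ij hj; rewrite E Order.POrderTheory.ltxx => /(_ (ltnW n4)).
    by have := Ttree_per_lt ji hi; rewrite E Order.POrderTheory.ltxx => /(_ (ltnW n4)).
  - have T0 : twin (Ttree (2 + q) 3 0) 0 (q - 1).
      have := @Ttree_twin (2 + q) 0; rewrite (_ : 2 + q - 3 - 0 = q - 1); last by lia.
      by apply; lia.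
    apply/per_iso/(twin_iso _ (twin_swap T0)); apply: Dtree_twin => //; lia.
  - by move=> i hi; apply: Ttree_per_lt => //; lia.
have q2 : 2 < q by lia.
have [f' [f'E f'V]] := D'tree_per p2 q2; have [f'' [f''E f''V]] := D''tree_per p2 q2.
split=> [T hT nD|hlt T hT nD nD'].
  have [//|iso|iso|[f [fE fV]]] := tree_cases p2 hpq hT.
  - rewrite (per_iso iso) f'E; split; first by nia.
    by split=> // _; nia.
  - rewrite (per_iso iso) f''E; split; first by nia.
    split=> [E|/per_iso]; last by rewrite (per_iso iso) f''E f'E; nia.
    (* Attaining the first bound with the value of the second forces [p = q], and then [D'tree] and
       [D''tree] are spiders with the same leaf counts. *)
    have pq : p = q by nia.
    apply: iso_trans iso _; apply: twin_iso (D''tree_twin p2 q2) _.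
    by rewrite -pq in q2 *; apply: D'tree_twin.
  - rewrite fE; split; first by nia.
    by split=> [|/per_iso]; [nia|rewrite fE f'E; nia].
have [//|//|iso|[f [fE fV]]] := tree_cases p2 hpq hT.
- rewrite (per_iso iso) f''E; split; first by nia.
  by split=> // _; nia.
rewrite fE; split; first by nia.
by split=> [|/per_iso]; [nia|rewrite fE f''E; nia].
Qed.
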